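(* Let the delay $r>0$, $\boldsymbol f(\cdot)\in C^1([-r,0];\mathbb R^d)$ and $M\in\mathbb R^{d\times d}$ be as in the context and let $\{\alpha_i\}_{i=1}^{2+d}\subset\mathbb R$ be given. Suppose there exist $\acute P\in\mathbb S^n$, $X\in\mathbb R^{n\times n}$, $V\in\mathbb R^{p\times n}$, $\acute Q\in\mathbb R^{n\times dn}$, $\acute R\in\mathbb S^{dn}$ and $\acute S,\acute U\in\mathbb S^n$ such that $$\begin{bmatrix}\acute P&\acute Q\\ *&\acute R+\mathsf F\otimes\acute S\end{bmatrix}\succ0,\quad\acute S\succ0,\quad\acute U\succ0,\qquad \mathsf{Sy}\left(\begin{bmatrix}I_n\\ \mathsf{Col}_{i=1}^{2+d}\alpha_iI_n\\ \mathsf O_{(q+m),n}\end{bmatrix}\begin{bmatrix}-X&\acute{\boldsymbol\Pi}\end{bmatrix}\right)+\begin{bmatrix}\mathsf O_n&\acute{\mathbf P}\\ *&\acute{\boldsymbol\Phi}\end{bmatrix}\prec0,$$ where $\mathsf F^{-1}=\int_{-r}^0\boldsymbol f(\tau)\boldsymbol f^\top(\tau)d\tau$, $\acute{\mathbf P}=[\acute P\ \ \mathsf O_n\ \ \acute Q\ \ \mathsf O_{n,q}\ \ \mathsf O_{n,m}]$, $$\acute{\boldsymbol\Pi}=\begin{bmatrix}\mathbf A[(I_{2+d}\otimes X)\oplus I_q]+\mathbf B_1[(I_{2+d}\otimes V)\oplus\mathsf O_q]&\mathsf O_{n,m}\end{bmatrix},$$ $$\acute{\boldsymbol\Phi}=\mathsf{Sy}\left(\begin{bmatrix}\acute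 Q\\ \mathsf O_{n,dn}\\ \acute R\\ \mathsf O_{(q+m),dn}\end{bmatrix}\begin{bmatrix}\mathbf F&\mathsf O_{dn,m}\end{bmatrix}\right)+(\acute S+r\acute U)\oplus(-\acute S)\oplus(-\mathsf F\otimes\acute U)\oplus(-J_3)\oplus J_1+\mathsf{Sy}\left(\begin{bmatrix}\mathsf O_{(2n+dn),m}\\ -J_2^\top\\ \widetilde J\end{bmatrix}\begin{bmatrix}\acute{\boldsymbol\Sigma}&\mathsf O_m\end{bmatrix}\right),$$ $\acute{\boldsymbol\Sigma}=[C_1X+B_4V\ \ C_2X+B_5V\ \ C_3(I_d\otimes X)+B_6(I_d\otimes V)\ \ D_2]$ and $\mathbf F=[F(0)\ \ -F(-r)\ \ -M\otimes I_n\ \ \mathsf O_{dn,q}]$. Then $X$ is invertible and, with $K=VX^{-1}$, the closed-loop system (CLS) of the context with supply rate function $\mathsf s$ is dissipative and the trivial solution $\boldsymbol x(t)\equiv\mathbf 0_n$ of the CLS with $\boldsymbol w(t)\equiv\mathbf 0_q$ is exponentially stable.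
   Context: Notation: $\mathsf{Sy}(X)=X+X^\top$; $\mathsf{Col}_{i}X_i$ stacks the $X_i$ vertically; $X\oplus Y$ is block diagonal; $\otimes$ is the Kronecker product; $\mathbb S^n$ = real symmetric $n\times n$ matrices; $\mathsf O_{n,m}$ zero matrix, $\mathsf O_n=\mathsf O_{n,n}$; $*$ denotes blocks determined by symmetry. Functions: $\boldsymbol f\in C^1([-r,0];\mathbb R^d)$ satisfies $\boldsymbol f'(\tau)=M\boldsymbol f(\tau)$ and $\int_{-r}^0\boldsymbol f\boldsymbol f^\top d\tau\succ0$; $F(\tau)=\boldsymbol f(\tau)\otimes I_n\in\mathbb R^{dn\times n}$. Open-loop system, for $t\ge t_0$: $\dot{\boldsymbol x}(t)=A_1\boldsymbol x(t)+A_2\boldsymbol x(t-r)+\int_{-r}^0A_3F(\tau)\boldsymbol x(t+\tau)d\tau+B_1\boldsymbol u(t)+B_2\boldsymbol u(t-r)+\int_{-r}^0B_3(\boldsymbol f(\tau)\otimes I_p)\boldsymbol u(t+\tau)d\tau+D_1\boldsymbol w(t)$, $\boldsymbol z(t)=C_1\boldsymbol x(t)+C_2\boldsymbol x(t-r)+\int_{-r}^0C_3F(\tau)\boldsymbol x(t+\tau)d\tau+B_4\boldsymbol u(t)+B_5\boldsymbol u(t-r)+\int_{-r}^0B_6(\boldsymbol f(\tau)\otimes I_p)\boldsymbol u(t+\tau)d\tau+D_2\boldsymbol w(t)$, with $\boldsymbol x(t)\in\mathbb R^n$, $\boldsymbol u(t)\in\mathbb R^p$, $\boldsymbol z(t)\in\mathbb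 R^m$, $\boldsymbol w\in\mathcal L^2([t_0,\infty);\mathbb R^q)$ and constant matrices of compatible size. CLS (with $\boldsymbol u=K\boldsymbol x$): $\dot{\boldsymbol x}(t)=(\mathbf A+\mathbf B_1[(I_{2+d}\otimes K)\oplus\mathsf O_q])\boldsymbol\chi(t)$, $\boldsymbol z(t)=(\mathbf C+\mathbf B_2[(I_{2+d}\otimes K)\oplus\mathsf O_q])\boldsymbol\chi(t)$, $t\ge t_0$, $\boldsymbol x(t_0+\theta)=\boldsymbol\phi(\theta)$ for $\theta\in[-r,0]$, $\boldsymbol\phi\in C([-r,0];\mathbb R^n)$, where $\boldsymbol\chi(t)$ stacks $\boldsymbol x(t)$, $\boldsymbol x(t-r)$, $\int_{-r}^0F(\tau)\boldsymbol x(t+\tau)d\tau$, $\boldsymbol w(t)$, and $\mathbf A=[A_1\ A_2\ A_3\ D_1]$, $\mathbf B_1=[B_1\ B_2\ B_3\ \mathsf O_{n,q}]$, $\mathbf C=[C_1\ C_2\ C_3\ D_2]$, $\mathbf B_2=[B_4\ B_5\ B_6\ \mathsf O_{m,q}]$. Supply rate: $\mathsf s(\boldsymbol z,\boldsymbol w)=\begin{bmatrix}\boldsymbol z\\ \boldsymbol w\end{bmatrix}^\top\begin{bmatrix}\widetilde J^\top J_1^{-1}\widetilde J&J_2\\ *&J_3\end{bmatrix}\begin{bmatrix}\boldsymbol z\\ \boldsymbol w\end{bmatrix}$ with $J_1\in\mathbb S^m$, $J_1^{-1}\prec0$, $\widetilde J\in\mathbb R^{m\times m}$, $J_2\in\mathbb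 R^{m\times q}$, $J_3\in\mathbb S^q$. Dissipative: there is a differentiable functional $\mathsf v:C([-r,0];\mathbb R^n)\to\mathbb R_{\ge0}$ such that $\frac{d}{dt}\mathsf v(\mathbf x_t(\cdot))-\mathsf s(\boldsymbol z(t),\boldsymbol w(t))\le0$ for all $t\ge t_0$ along the CLS, where $\mathbf x_t(\theta)=\boldsymbol x(t+\theta)$, $\theta\in[-r,0]$. *)

(* Defs.v *)
From HB Require Import structures.
From mathcomp Require Import all_boot all_order all_algebra.
From mathcomp Require Import mxtens.
From mathcomp Require Import all_classical all_reals all_analysis.

Set Implicit Arguments.
Unset Strict Implicit.
Unset Printing Implicit Defensive.

Import Order.TTheory GRing.Theory Num.Theory.
Import numFieldNormedType.Exports.

Local Open Scope classical_set_scope.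
Local Open Scope ring_scope.

Notation "A *t B" := (tensmx A B)
  (at level 40, left associativity, format "A  *t  B") : ring_scope.

(* Block columns of heights n, n, d * n are typed by (2 + d) * n, which is
   convertible to n + (n + d * n); the remaining blocks are then appended on
   the right, so that every block matrix below is bracketed as
   ((_ , (_ , _)), _), _. *)

Section Matrices.
Context {R : realType}.

Definition Sy n (X : 'M[R]_n) : 'M[R]_n := X + X^T.

Definition dsum a b c e (X : 'M[R]_(a, b)) (Y : 'M[R]_(c, e)) :
  'M[R]_(a + c, b + e) := block_mx X 0 0 Y.

Definition posdefmx n (A : 'M[R]_n) : Prop :=
  A^T = A /\ forall u : 'cV[R]_n, u != 0 -> 0 < (u^T *m A *m u) 0 0.

Definition negdefmx n (A : 'M[R]_n) : Prop := posdefmx (- A).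

(* a (x) I_n for a column a, with its 1 * n columns retyped as n columns;
   equivalently, the vertical stack of the blocks (a_i I_n). *)
Definition kroncol k n (a : 'cV[R]_k) : 'M[R]_(k * n, n) :=
  castmx (erefl _, mul1n n) (a *t (1%:M : 'M[R]_n)).

Definition mxint a b (D : set R) (G : R -> 'M[R]_(a, b)) : 'M[R]_(a, b) :=
  \matrix_(i, j) (\int[lebesgue_measure]_(t in D) G t i j)%R.

Definition row4 k n d q (A1 A2 : 'M[R]_(k, n)) (A3 : 'M[R]_(k, d * n))
  (D : 'M[R]_(k, q)) : 'M[R]_(k, (2 + d) * n + q) :=
  row_mx (row_mx A1 (row_mx A2 A3)) D.

Definition col4 k n d q (A1 A2 : 'M[R]_(n, k)) (A3 : 'M[R]_(d * n, k))
  (D : 'M[R]_(q, k)) : 'M[R]_((2 + d) * n + q, k) :=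
  col_mx (col_mx A1 (col_mx A2 A3)) D.

Definition closed_loop k n p q d (A : 'M[R]_(k, (2 + d) * n + q))
  (B : 'M[R]_(k, (2 + d) * p + q)) (K : 'M[R]_(p, n)) :
  'M[R]_(k, (2 + d) * n + q) :=
  A + B *m dsum ((1%:M : 'M[R]_(2 + d)) *t K) (0 : 'M[R]_q).

End Matrices.

Section Functions.
Context {R : realType}.

(* Difference quotients are taken with s in D: one-sided at an endpoint of D. *)
Definition is_derive_within (V : normedModType R) (D : set R) (g : R -> V)
  (t : R) (l : V) : Prop :=
  (s - t)^-1 *: (g s - g t) @[s --> within D t^'] --> l.

Definition C1_on (V : normedModType R) (D : set R) (g : R -> V) : Prop :=
  exists g' : R -> V, {within D, continuous g'} /\
    forall t, D t -> is_derive_within D g t (g' t).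

Definition abs_continuous_on (V : normedModType R) (a b : R) (g : R -> V) :
  Prop :=
  forall e : R, 0 < e -> exists2 dl : R, 0 < dl &
    forall (k : nat) (u v : 'I_k -> R),
      (forall i, a <= u i /\ u i <= v i /\ v i <= b) ->
      trivIset [set: 'I_k] (fun i => `]u i, v i[%classic) ->
      \sum_i (v i - u i) < dl -> \sum_i `|g (v i) - g (u i)| < e.

Definition square_integrable_on q (D : set R) (w : R -> 'cV[R]_q) : Prop :=
  forall i, measurable_fun D (fun t => w t i 0) /\
    (\int[lebesgue_measure]_(t in D) ((w t i 0) ^+ 2)%:E < +oo)%E.

(* An element of C([-r,0];R^n) is represented by a total function, of which
   only the restriction to [-r,0] matters. *)
Definition history r n (phi : R -> 'cV[R]_n) : Prop :=
  {within `[- r, 0]%classic, continuous phi}.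

Definition supnorm r n (phi : R -> 'cV[R]_n) : R :=
  sup [set `|phi th| | th in `[- r, 0]%classic].

Definition functional_on_histories r n (v : (R -> 'cV[R]_n) -> R) : Prop :=
  forall phi psi : R -> 'cV[R]_n,
    (forall th, - r <= th <= 0 -> phi th = psi th) -> v phi = v psi.

(* Frechet differentiability on C([-r,0];R^n) with the supremum norm. *)
Definition differentiable_functional r n (v : (R -> 'cV[R]_n) -> R) : Prop :=
  forall phi, history r phi -> exists L : (R -> 'cV[R]_n) -> R,
    [/\ forall (a : R) h k, history r h -> history r k ->
          L (fun th => a *: h th + k th) = a * L h + L k,
        exists c : R, forall h, history r h -> `|L h| <= c * supnorm r h
      & forall e : R, 0 < e -> exists2 dl : R, 0 < dl &
          forall h, history r h -> supnorm r h <= dl ->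
          `|v (fun th => phi th + h th) - v phi - L h| <= e * supnorm r h].

End Functions.

Section ClosedLoopSystem.
Context {R : realType}.
Variables (n q d : nat) (t0 r : R) (f : R -> 'cV[R]_d).

Definition chi (x : R -> 'cV[R]_n) (w : R -> 'cV[R]_q) (t : R) :
  'cV[R]_((2 + d) * n + q) :=
  col4 (x t) (x (t - r))
    (mxint `[- r, 0]%classic (fun th => kroncol n (f th) *m x (t + th)))
    (w t).

Variable Acl : 'M[R]_(n, (2 + d) * n + q).

Definition cls_holds_at (x : R -> 'cV[R]_n) (w : R -> 'cV[R]_q) (t : R) :
  Prop :=
  is_derive_within `[t0, +oo[%classic x t (Acl *m chi x w t).

(* As w is only square integrable, solutions are taken in the sense of
   Caratheodory: x is locally absolutely continuous on [t0, +oo[ and satisfies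
   the differential equation almost everywhere.  This includes every x that is
   differentiable and satisfies the equation at all t >= t0. *)
Definition cls_solution (phi : R -> 'cV[R]_n) (w : R -> 'cV[R]_q)
  (x : R -> 'cV[R]_n) : Prop :=
  [/\ {within `[t0 - r, +oo[%classic, continuous x},
      forall th, - r <= th <= 0 -> x (t0 + th) = phi th,
      forall T, t0 <= T -> abs_continuous_on t0 T x
    & {ae lebesgue_measure, forall t, t0 <= t -> cls_holds_at x w t}].

(* The dissipation inequality is required at every instant at which the
   differential equation holds: all t >= t0 for an everywhere differentiable
   solution, almost every t >= t0 in general. *)
Definition dissipative m (Ccl : 'M[R]_(m, (2 + d) * n + q))
  (s : 'cV[R]_m -> 'cV[R]_q -> R) : Prop :=
  exists v : (R -> 'cV[R]_n) -> R,
    [/\ functional_on_histories r v,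
        forall phi, history r phi -> 0 <= v phi,
        differentiable_functional r v
      & forall phi w x, history r phi ->
          square_integrable_on `[t0, +oo[%classic w -> cls_solution phi w x ->
          forall t, t0 <= t -> cls_holds_at x w t ->
          exists2 dv : R,
            is_derive_within (V := R^o) `[t0, +oo[%classic
              (fun t' => v (fun th => x (t' + th))) t dv
          & dv - s (Ccl *m chi x w t) (w t) <= 0].

Definition exponentially_stable : Prop :=
  exists c la : R, [/\ 0 < c, 0 < la &
    forall phi x, history r phi -> cls_solution phi (fun=> 0) x ->
    forall t, t0 <= t -> `|x t| <= c * supnorm r phi * expR (- la * (t - t0))].

End ClosedLoopSystem.

Section SupplyRate.
Context {R : realType}.

Definition supply m q (J1 Jt : 'M[R]_m) (J2 : 'M[R]_(m, q)) (J3 : 'M[R]_q)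
  (z : 'cV[R]_m) (w : 'cV[R]_q) : R :=
  ((col_mx z w)^T *m block_mx (Jt^T *m invmx J1 *m Jt) J2 J2^T J3
     *m col_mx z w) 0 0.

End SupplyRate.

Section LMI.
Context {R : realType}.
Variables (n p q m d : nat) (r : R) (f : R -> 'cV[R]_d) (M : 'M[R]_d).

Definition gram : 'M[R]_d :=
  mxint `[- r, 0]%classic (fun th => f th *m (f th)^T).

Definition sfF : 'M[R]_d := invmx gram.

Definition LMI_P (P : 'M[R]_n) (Q : 'M[R]_(n, d * n)) :
  'M[R]_(n, (2 + d) * n + q + m) :=
  row_mx (row4 P 0 Q 0) 0.

Definition LMI_Pi (bA : 'M[R]_(n, (2 + d) * n + q))
  (bB1 : 'M[R]_(n, (2 + d) * p + q)) (X : 'M[R]_n) (V : 'M[R]_(p, n)) :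
  'M[R]_(n, (2 + d) * n + q + m) :=
  row_mx (bA *m dsum ((1%:M : 'M[R]_(2 + d)) *t X) (1%:M : 'M[R]_q)
          + bB1 *m dsum ((1%:M : 'M[R]_(2 + d)) *t V) (0 : 'M[R]_q)) 0.

Definition bF : 'M[R]_(d * n, (2 + d) * n + q) :=
  row4 (kroncol n (f 0)) (- kroncol n (f (- r)))
       (- (M *t (1%:M : 'M[R]_n))) 0.

Definition LMI_Sigma (C1 C2 : 'M[R]_(m, n)) (C3 : 'M[R]_(m, d * n))
  (D2 : 'M[R]_(m, q)) (B4 B5 : 'M[R]_(m, p)) (B6 : 'M[R]_(m, d * p))
  (X : 'M[R]_n) (V : 'M[R]_(p, n)) : 'M[R]_(m, (2 + d) * n + q) :=
  row4 (C1 *m X + B4 *m V) (C2 *m X + B5 *m V)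
       (C3 *m ((1%:M : 'M[R]_d) *t X) + B6 *m ((1%:M : 'M[R]_d) *t V)) D2.

Definition LMI_Phi (Q : 'M[R]_(n, d * n)) (Rm : 'M[R]_(d * n))
  (S U : 'M[R]_n) (Sigma : 'M[R]_(m, (2 + d) * n + q))
  (J1 Jt : 'M[R]_m) (J2 : 'M[R]_(m, q)) (J3 : 'M[R]_q) :
  'M[R]_((2 + d) * n + q + m) :=
  Sy (col_mx (col4 Q 0 Rm (0 : 'M[R]_(q, d * n))) (0 : 'M[R]_(m, d * n))
      *m row_mx bF (0 : 'M[R]_(d * n, m)))
  + dsum (dsum (dsum (S + r *: U) (dsum (- S) (- (sfF *t U)))) (- J3)) J1
  + Sy (col_mx (col_mx (0 : 'M[R]_((2 + d) * n, m)) (- J2^T)) Jt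
        *m row_mx Sigma (0 : 'M[R]_m)).

Definition LMI_multiplier (alpha : 'I_(2 + d) -> R) :
  'M[R]_(n + ((2 + d) * n + q + m), n) :=
  col_mx (1%:M : 'M[R]_n)
    (col_mx (col_mx (kroncol n (\col_i alpha i)) (0 : 'M[R]_(q, n)))
            (0 : 'M[R]_(m, n))).

Definition LMI_main (alpha : 'I_(2 + d) -> R) (X : 'M[R]_n)
  (Pi P : 'M[R]_(n, (2 + d) * n + q + m)) (Phi : 'M[R]_((2 + d) * n + q + m)) :
  'M[R]_(n + ((2 + d) * n + q + m)) :=
  Sy (LMI_multiplier alpha *m row_mx (- X) Pi)
  + block_mx (0 : 'M[R]_n) P P^T Phi.

End LMI.

(* Main.v *)
Require Import Defs.
From HB Require Import structures.
From mathcomp Require Import all_boot all_order all_algebra.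
From mathcomp Require Import mxtens.
From mathcomp Require Import all_classical all_reals all_analysis.
From mathcomp Require Import ring lra.

(** The storage function is the Krasovskii functional
    [v = Z^T [P, Q; Q^T, R] Z + int y^T (S + (th + r) U) y] over one delay
    interval, written in the variable [y = X^-1 x], with [Z] stacking [y(0)] and
    the moments [eta = int F y].  In this variable no congruence transformation
    is needed: the matrices of the inequalities are the matrices of [v].

    Since [f' = M f], integration by parts over the sliding window
    ([window_derive]) expresses the derivative of [eta], hence that of [v], by
    [y(t)], [y(t - r)], [eta] and the derivative of [y], except for the term
    [- int y^T U y], which Bessel's inequality ([matrix_Bessel]) bounds by
    [- eta^T (F *t U) eta].  The main inequality is evaluated at the vector made
    of the derivative of [y], the rescaled [chi], and [zeta = - J1^-1 Jt z]
    ([bform_LMI_main], [supply_completion]).  The closed-loop equation says that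
    the right factor [[- X, Pi]] of the multiplier term kills this vector, so the
    value is exactly the bound for the derivative of [v] minus the supply rate,
    and it is at most [- e (|y|^2 + |eta|^2)] ([LMI_dissipation]).  The top left
    block of the same inequality makes [X + X^T] definite, so [X] is invertible.
    Bessel's inequality for [S] and the first inequality give
    [v >= e' |y(0)|^2] ([lkfun_lower]).  Frechet differentiability holds because
    [v] is the quadratic functional of a bounded bilinear form
    ([differentiable_quadratic]).

    For stability take [w = 0].  The supply rate is then nonpositive, because
    [J1^-1] is negative definite.  Keeping a small fraction of [int y^T U y] in
    the derivative gives [v' <= - la v], and the two-sided bounds on [v] give
    exponential decay.  A solution satisfies its equation only almost everywhere,
    but its right-hand side is continuous when [w = 0]; a covering argument for
    absolutely continuous functions ([ac_increment], [ac_derive_everywhere]) then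
    yields the equation, and with it [v' <= - la v], at every instant. *)

Set Implicit Arguments.
Unset Strict Implicit.
Unset Printing Implicit Defensive.

Import Order.TTheory GRing.Theory Num.Theory.
Import numFieldNormedType.Exports.

Local Open Scope classical_set_scope.
Local Open Scope ring_scope.

(** * Quadratic forms *)

Section QuadraticForms.
Context {R : realType}.

Definition bform k l (A : 'M[R]_(k, l)) (u : 'cV[R]_k) (v : 'cV[R]_l) : R :=
  (u^T *m A *m v) 0 0.

Definition sqn k (u : 'cV[R]_k) : R := \sum_i u i 0 ^+ 2.

Lemma bformE k l (A : 'M[R]_(k, l)) u v :
  bform A u v = \sum_i \sum_j A i j * (u i 0 * v j 0).
Proof.
rewrite /bform mxE exchange_big /=; apply: eq_bigr => j _.
rewrite mxE mulr_suml; apply: eq_bigr => i _; rewrite mxE; ring.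
Qed.

Lemma bformT k l (A : 'M[R]_(k, l)) u v : bform A^T v u = bform A u v.
Proof.
rewrite !bformE exchange_big; apply: eq_bigr => i _; apply: eq_bigr => j _.
by rewrite mxE [v j 0 * _]mulrC.
Qed.

Lemma bformDl k l (A B : 'M[R]_(k, l)) u v :
  bform (A + B) u v = bform A u v + bform B u v.
Proof. by rewrite /bform mulmxDr mulmxDl mxE. Qed.

Lemma bformNl k l (A : 'M[R]_(k, l)) u v : bform (- A) u v = - bform A u v.
Proof. by rewrite /bform mulmxN mulNmx mxE. Qed.

Lemma bformZl k l c (A : 'M[R]_(k, l)) u v : bform (c *: A) u v = c * bform A u v.
Proof. by rewrite /bform -scalemxAr -scalemxAl mxE. Qed.

Lemma bform0l k l (u : 'cV[R]_k) (v : 'cV[R]_l) : bform 0 u v = 0.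
Proof. by rewrite /bform mulmx0 mul0mx mxE. Qed.

Lemma bformDr k l (A : 'M[R]_(k, l)) u v w :
  bform A u (v + w) = bform A u v + bform A u w.
Proof. by rewrite /bform mulmxDr mxE. Qed.

Lemma bformZr k l c (A : 'M[R]_(k, l)) u v : bform A u (c *: v) = c * bform A u v.
Proof. by rewrite /bform -scalemxAr mxE. Qed.

Lemma bformNr k l (A : 'M[R]_(k, l)) u v : bform A u (- v) = - bform A u v.
Proof. by rewrite /bform mulmxN mxE. Qed.

Lemma bformM k l a (A : 'M[R]_(k, a)) (B : 'M[R]_(a, l)) u v :
  bform (A *m B) u v = bform A u (B *m v).
Proof. by rewrite /bform !mulmxA. Qed.

Lemma bform_mull k l a (A : 'M[R]_(k, l)) (B : 'M[R]_(k, a)) u v :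
  bform A (B *m u) v = bform (B^T *m A) u v.
Proof. by rewrite /bform trmx_mul !mulmxA. Qed.

Lemma bform_Sy k (A : 'M[R]_k) u : bform (Sy A) u u = 2 * bform A u u.
Proof. rewrite /Sy bformDl bformT; ring. Qed.

Lemma bform_block k1 k2 l1 l2 (A : 'M[R]_(k1, l1)) (B : 'M[R]_(k1, l2))
  (C : 'M[R]_(k2, l1)) (D : 'M[R]_(k2, l2)) u1 u2 v1 v2 :
  bform (block_mx A B C D) (col_mx u1 u2) (col_mx v1 v2) =
  bform A u1 v1 + bform B u1 v2 + bform C u2 v1 + bform D u2 v2.
Proof.
rewrite /bform tr_col_mx mul_row_block mul_row_col !mulmxDl !mxE; ring.
Qed.

Lemma bform_row k l1 l2 (A : 'M[R]_(k, l1)) (B : 'M[R]_(k, l2)) u v1 v2 :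
  bform (row_mx A B) u (col_mx v1 v2) = bform A u v1 + bform B u v2.
Proof. by rewrite /bform -mulmxA mul_row_col mulmxDr !mulmxA mxE. Qed.

Lemma bform_col k1 k2 l (A : 'M[R]_(k1, l)) (B : 'M[R]_(k2, l)) u1 u2 v :
  bform (col_mx A B) (col_mx u1 u2) v = bform A u1 v + bform B u2 v.
Proof. by rewrite /bform tr_col_mx mul_row_col mulmxDl mxE. Qed.

Lemma bform_dsum k1 k2 l1 l2 (A : 'M[R]_(k1, l1)) (B : 'M[R]_(k2, l2))
  u1 u2 v1 v2 :
  bform (dsum A B) (col_mx u1 u2) (col_mx v1 v2) = bform A u1 v1 + bform B u2 v2.
Proof. by rewrite /dsum bform_block !bform0l !addr0. Qed.

Lemma sqn_ge0 k (u : 'cV[R]_k) : 0 <= sqn u.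
Proof. by apply: sumr_ge0 => i _; exact: sqr_ge0. Qed.

Lemma sqn_col k l (u : 'cV[R]_k) (v : 'cV[R]_l) :
  sqn (col_mx u v) = sqn u + sqn v.
Proof.
rewrite /sqn big_split_ord /=.
by congr (_ + _); apply: eq_bigr => i _; rewrite ?col_mxEu ?col_mxEd.
Qed.

Lemma le_sqn_coord k (u : 'cV[R]_k) i : u i 0 ^+ 2 <= sqn u.
Proof.
rewrite /sqn (bigD1 i) //= lerDl; apply: sumr_ge0 => j _; exact: sqr_ge0.
Qed.

Lemma posdef_sym k (A : 'M[R]_k) : posdefmx A -> A^T = A.
Proof. by case. Qed.

Lemma posdef_gt0 k (A : 'M[R]_k) u : posdefmx A -> u != 0 -> 0 < bform A u u.
Proof. by case=> _ h /h. Qed.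

Lemma posdef_ge0 k (A : 'M[R]_k) u : posdefmx A -> 0 <= bform A u u.
Proof.
move=> pA; have [->|u0] := eqVneq u 0; last exact/ltW/posdef_gt0.
by rewrite /bform mulmx0 mxE.
Qed.

Lemma unitmx_Sy_posdef k (A : 'M[R]_k) : posdefmx (Sy A) -> A \in unitmx.
Proof.
move=> pA; rewrite -row_free_unit; apply: inj_row_free => v vA0.
apply/eqP; apply: contraT => v0.
have vT0 : v^T != 0 by apply: contra v0 => /eqP h; rewrite -[v]trmxK h trmx0.
have := posdef_gt0 pA vT0.
by rewrite bform_Sy /bform trmxK vA0 mul0mx mxE mulr0 ltxx.
Qed.

Lemma posdef_unitmx k (A : 'M[R]_k) : posdefmx A -> A \in unitmx.
Proof.
move=> [sA hA]; apply: unitmx_Sy_posdef; split; first by rewrite /Sy raddfD/= trmxK addrC.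
by move=> u u0; rewrite -/(bform _ u u) bform_Sy mulr_gt0 //; exact: hA.
Qed.

(** Positivity of the form at [u - t v], with [t] the minimiser
    [(u^T A v) / (v^T A v)]. *)
Lemma posdef_CauchySchwarz k (A : 'M[R]_k) u v : posdefmx A ->
  bform A u v ^+ 2 <= bform A u u * bform A v v.
Proof.
move=> pA; have [->|v0] := eqVneq v 0.
  by rewrite /bform !mulmx0 mxE expr0n mulr0.
have vv := posdef_gt0 pA v0; set c := bform A v v in vv *.
set b := bform A u v; pose t := b / c.
have vu : bform A v u = b by rewrite -bformT (posdef_sym pA).
have := posdef_ge0 (u + (- t) *: v) pA.
have -> : bform A (u + - t *: v) (u + - t *: v) = bform A u u - b ^+ 2 / c.
  rewrite bformDr bformZr -!(bformT A (u + _)) (posdef_sym pA).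
  rewrite !bformDr !bformZr vu -/b -/c /t.
  field; exact: lt0r_neq0.
by rewrite subr_ge0 ler_pdivrMr.
Qed.

(** Cauchy-Schwarz in the inner product of [A], against the columns of [A^-1],
    bounds each coordinate: [u_i ^ 2 = (u^T A (A^-1 e_i)) ^ 2] is at most
    [(u^T A u) (A^-1)_ii].  Summing over [i] gives coercivity without any
    compactness or spectral argument. *)
Lemma posdef_coercive k (A : 'M[R]_k) : posdefmx A ->
  exists2 e : R, 0 < e & forall u, e * sqn u <= bform A u u.
Proof.
move=> pA; have uA := posdef_unitmx pA.
have coordE (u : 'cV[R]_k) i : u i 0 ^+ 2 <= bform A u u * invmx A i i.
  have := posdef_CauchySchwarz u (invmx A *m delta_mx i 0) pA.
  have -> : bform A u (invmx A *m delta_mx i 0) = u i 0.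
    by rewrite -bformM mulmxV // /bform mulmx1 -colE !mxE.
  have -> // : bform A (invmx A *m delta_mx i 0) (invmx A *m delta_mx i 0)
               = invmx A i i.
  rewrite bform_mull -bformM -mulmxA mulmxV // mulmx1 trmx_inv (posdef_sym pA).
  by rewrite /bform trmx_delta -rowE -colE !mxE.
have dg i : 0 <= invmx A i i.
  have n0 : (delta_mx i 0 : 'cV[R]_k) != 0.
    apply/eqP => /matrixP/(_ i 0); rewrite !mxE !eqxx /= => /eqP.
    by rewrite oner_eq0.
  have := coordE (delta_mx i 0) i; rewrite !mxE !eqxx /= expr1n => h.
  by rewrite -(pmulr_rge0 _ (posdef_gt0 pA n0)); apply: le_trans h.
pose T := \sum_i invmx A i i.
have T0 : 0 <= T by apply: sumr_ge0.
exists (T + 1)^-1; first by rewrite invr_gt0; lra.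
move=> u; rewrite mulrC ler_pdivrMr; last lra.
apply: (@le_trans _ _ (bform A u u * T)); last first.
  by rewrite ler_wpM2l ?posdef_ge0 //; lra.
by rewrite /T mulr_sumr; apply: ler_sum.
Qed.

Lemma bform_bound k (A : 'M[R]_k) :
  exists2 c : R, 0 < c & forall u, `|bform A u u| <= c * sqn u.
Proof.
pose c := \sum_i \sum_j `|A i j|.
have c0 : 0 <= c by do 2 (apply: sumr_ge0 => ? _).
exists (c + 1); first lra.
move=> u; apply: (@le_trans _ _ (c * sqn u)); last first.
  by rewrite ler_wpM2r ?sqn_ge0 //; lra.
rewrite bformE (le_trans (ler_norm_sum _ _ _)) // mulr_suml ler_sum // => i _.
rewrite (le_trans (ler_norm_sum _ _ _)) // mulr_suml ler_sum // => j _.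
rewrite normrM ler_wpM2l // ler_norml.
have := le_sqn_coord u i; have := le_sqn_coord u j.
have := sqr_ge0 (u i 0 - u j 0); have := sqr_ge0 (u i 0 + u j 0).
move: (sqn u) (u i 0) (u j 0) => s a b; rewrite !sqrrD => *; nra.
Qed.

Lemma posdef_dominates k (A B : 'M[R]_k) : posdefmx A ->
  exists2 c : R, 0 < c & forall u, bform B u u <= c * bform A u u.
Proof.
move=> /posdef_coercive[e e0 he]; have [c c0 hc] := bform_bound B.
exists (c / e); first exact: divr_gt0.
move=> u; apply: (le_trans (ler_norm _)); apply: (le_trans (hc u)).
by rewrite mulrAC ler_pdivlMr // -mulrA ler_wpM2l ?(ltW c0)// mulrC.
Qed.

End QuadraticForms.

(** * Kronecker products and column-major vectorisation *)

Section Kronecker.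
Context {R : realType}.

Lemma mxtens_unindexL d a (i : 'I_a) :
  mxtens_unindex (lshift (d * a) i : 'I_(d.+1 * a)) = (ord0, i).
Proof.
congr (_, _); apply: val_inj => /=; first by rewrite divn_small.
by rewrite modn_small.
Qed.

Lemma mxtens_unindexR d a (k : 'I_(d * a)) :
  mxtens_unindex (rshift a k : 'I_(d.+1 * a)) =
  (lift ord0 (mxtens_unindex k).1, (mxtens_unindex k).2).
Proof.
have a0 : (0 < a)%N by case: a k => [k|//]; case: k => k; rewrite muln0.
congr (_, _); apply: val_inj => /=; last by rewrite modnDl.
by rewrite divnDl ?dvdnn // divnn a0.
Qed.

Lemma tens1S d a b (X : 'M[R]_(a, b)) :
  ((1%:M : 'M[R]_(d.+1)) *t X : 'M[R]_(a + d * a, b + d * b)) =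
  block_mx X 0 0 ((1%:M : 'M[R]_d) *t X).
Proof.
apply/matrixP => i j.
case: (split_ordP i) => i' ->; case: (split_ordP j) => j' ->.
- rewrite block_mxEul mxE (mxtens_unindexL d i') (mxtens_unindexL d j') /=.
  by rewrite mxE eqxx mul1r.
- rewrite block_mxEur mxE (mxtens_unindexL d i') (mxtens_unindexR j') /=.
  by rewrite !mxE eq_liftF mul0r.
- rewrite block_mxEdl mxE (mxtens_unindexR i') (mxtens_unindexL d j') /=.
  by rewrite !mxE eq_sym eq_liftF mul0r.
- rewrite block_mxEdr mxE (mxtens_unindexR i') (mxtens_unindexR j') /=.
  by rewrite !mxE (inj_eq lift_inj).
Qed.

(** The dimension [(2 + d) * a] unfolds to [a + (a + d * a)], so the block
    structure of the stacked vectors is visible without any cast. *)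
Lemma tens1SS d a b (X : 'M[R]_(a, b)) :
  ((1%:M : 'M[R]_(2 + d)) *t X : 'M[R]_(a + (a + d * a), b + (b + d * b))) =
  dsum X (dsum X ((1%:M : 'M[R]_d) *t X)).
Proof. by rewrite (tens1S d.+1 X) (tens1S d X). Qed.

Lemma mul_row4_dsum k a b d q q' (A1 A2 : 'M[R]_(k, a)) (A3 : 'M[R]_(k, d * a))
  (D : 'M[R]_(k, q)) (X : 'M[R]_(a, b)) (E : 'M[R]_(q, q')) :
  row4 A1 A2 A3 D *m dsum ((1%:M : 'M[R]_(2 + d)) *t X) E =
  row4 (A1 *m X) (A2 *m X) (A3 *m ((1%:M : 'M[R]_d) *t X)) (D *m E).
Proof.
rewrite /row4 /dsum mul_row_block !mulmx0 addr0 add0r; congr row_mx.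
rewrite (tens1SS d X).
change (row_mx A1 (row_mx A2 A3) *m dsum X (dsum X ((1%:M : 'M[R]_d) *t X))
  = row_mx (A1 *m X) (row_mx (A2 *m X) (A3 *m ((1%:M : 'M[R]_d) *t X)))).
by rewrite /dsum !mul_row_block !mulmx0 !addr0 !add0r.
Qed.

Lemma mul_dsum_col4 k a b d q q' (y1 y2 : 'M[R]_(b, k)) (y3 : 'M[R]_(d * b, k))
  (w : 'M[R]_(q', k)) (X : 'M[R]_(a, b)) (E : 'M[R]_(q, q')) :
  dsum ((1%:M : 'M[R]_(2 + d)) *t X) E *m col4 y1 y2 y3 w =
  col4 (X *m y1) (X *m y2) (((1%:M : 'M[R]_d) *t X) *m y3) (E *m w).
Proof.
rewrite /col4 /dsum mul_block_col !mul0mx addr0 add0r; congr col_mx.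
rewrite (tens1SS d X).
change (dsum X (dsum X ((1%:M : 'M[R]_d) *t X)) *m col_mx y1 (col_mx y2 y3)
  = col_mx (X *m y1) (col_mx (X *m y2) (((1%:M : 'M[R]_d) *t X) *m y3))).
by rewrite /dsum !mul_block_col !mul0mx !addr0 !add0r.
Qed.

Lemma mul_row4_col4 k l a d q (A1 A2 : 'M[R]_(k, a)) (A3 : 'M[R]_(k, d * a))
  (D : 'M[R]_(k, q)) (y1 y2 : 'M[R]_(a, l)) (y3 : 'M[R]_(d * a, l))
  (w : 'M[R]_(q, l)) :
  row4 A1 A2 A3 D *m col4 y1 y2 y3 w =
  A1 *m y1 + A2 *m y2 + A3 *m y3 + D *m w.
Proof.
rewrite /row4 /col4 mul_row_col; congr (_ + _).
by rewrite (mul_row_col A1) mul_row_col addrA.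
Qed.

(** The column-major vec operator, in the index order of [*t]: it turns
    [A *t B] into [G |-> B G A^T] and the distributed state [int F x] into the
    vectorisation of the matrix [int x f^T]. *)
Definition cvec n d (G : 'M[R]_(n, d)) : 'cV[R]_(d * n) :=
  \col_k G (mxtens_unindex k).2 (mxtens_unindex k).1.

Lemma kroncolE n d (a : 'cV[R]_d) k j :
  kroncol n a k j =
  a (mxtens_unindex k).1 0 * ((mxtens_unindex k).2 == j)%:R.
Proof.
rewrite /kroncol castmxE mxE cast_ord_id; congr (_ * _).
  by congr (a _ _); rewrite ord1.
by rewrite mxE; congr (_ == _)%:R; apply: val_inj; rewrite /= modn_small.
Qed.

Lemma kroncol_cvec n d (a : 'cV[R]_d) (y : 'cV[R]_n) :
  kroncol n a *m y = cvec (y *m a^T).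
Proof.
apply/colP => k; rewrite !mxE big_ord_recl big_ord0 addr0 !mxE.
rewrite (bigD1 (mxtens_unindex k).2) //= big1 => [|j jk].
  by rewrite kroncolE eqxx mulr1 addr0 mulrC.
by rewrite kroncolE eq_sym (negPf jk) mulr0 mul0r.
Qed.

Lemma sum_mxtens m n (F : 'I_m -> 'I_n -> R) :
  \sum_(k < m * n) F (mxtens_unindex k).1 (mxtens_unindex k).2 =
  \sum_i \sum_j F i j.
Proof.
rewrite pair_big /=; symmetry.
rewrite (reindex (@mxtens_unindex m n)) //=.
by exists (@mxtens_index m n) => i _; rewrite (mxtens_indexK, mxtens_unindexK).
Qed.

Lemma mul_tens_cvec n n' d d' (A : 'M[R]_(d', d)) (B : 'M[R]_(n', n))
  (G : 'M[R]_(n, d)) : (A *t B) *m cvec G = cvec (B *m G *m A^T).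
Proof.
apply/colP => k; rewrite !mxE.
under eq_bigr do rewrite !mxE.
rewrite (sum_mxtens (fun i j => A (mxtens_unindex k).1 i
   * B (mxtens_unindex k).2 j * G j i)).
apply: eq_bigr => i _; rewrite !mxE mulr_suml; apply: eq_bigr => j _; ring.
Qed.

Lemma dot_cvec n d (G H : 'M[R]_(n, d)) :
  ((cvec G)^T *m cvec H) 0 0 = \tr (G^T *m H).
Proof.
rewrite mxE /mxtrace.
under eq_bigr do rewrite !mxE.
rewrite (sum_mxtens (fun i j => G j i * H j i)).
by apply: eq_bigr => i _; rewrite mxE; apply: eq_bigr => j _; rewrite mxE.
Qed.

Lemma bform_tens_cvec n d (A : 'M[R]_d) (B : 'M[R]_n) (G : 'M[R]_(n, d)) :
  bform (A *t B) (cvec G) (cvec G) = \tr (G^T *m B *m G *m A^T).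
Proof. by rewrite /bform -mulmxA mul_tens_cvec dot_cvec !mulmxA. Qed.

Lemma cvecD n d (G H : 'M[R]_(n, d)) : cvec (G + H) = cvec G + cvec H.
Proof. by apply/colP => k; rewrite !mxE. Qed.

Lemma cvecN n d (G : 'M[R]_(n, d)) : cvec (- G) = - cvec G.
Proof. by apply/colP => k; rewrite !mxE. Qed.

End Kronecker.

(** * The main matrix inequality as a quadratic form *)

Section LMIEvaluation.
Context {R : realType}.

Lemma bformNm k l (A : 'M[R]_(k, l)) u v : bform A (- u) v = - bform A u v.
Proof. by rewrite /bform raddfN /= !mulNmx mxE. Qed.

Lemma bform1M k l (A : 'M[R]_(k, l)) u v : bform 1%:M u (A *m v) = bform A u v.
Proof. by rewrite -bformM mul1mx. Qed.

Lemma bform_row4 k n d q (A1 A2 : 'M[R]_(k, n)) (A3 : 'M[R]_(k, d * n))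
  (D : 'M[R]_(k, q)) u v1 v2 v3 w :
  bform (row4 A1 A2 A3 D) u (col4 v1 v2 v3 w) =
  bform A1 u v1 + bform A2 u v2 + bform A3 u v3 + bform D u w.
Proof. by rewrite -bform1M mul_row4_col4 !bformDr !bform1M. Qed.

Lemma tr_col4 k n d q (A1 A2 : 'M[R]_(n, k)) (A3 : 'M[R]_(d * n, k))
  (D : 'M[R]_(q, k)) : (col4 A1 A2 A3 D)^T = row4 A1^T A2^T A3^T D^T.
Proof.
rewrite /col4 /row4 tr_col_mx; congr row_mx.
by rewrite (tr_col_mx A1) (tr_col_mx A2).
Qed.

Lemma bform_col4 k n d q (A1 A2 : 'M[R]_(n, k)) (A3 : 'M[R]_(d * n, k))
  (D : 'M[R]_(q, k)) u v1 v2 v3 w :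
  bform (col4 A1 A2 A3 D) (col4 v1 v2 v3 w) u =
  bform A1 v1 u + bform A2 v2 u + bform A3 v3 u + bform D w u.
Proof. by rewrite -bformT tr_col4 bform_row4 !bformT. Qed.

Variables (n p q m d : nat).

Lemma mul_closed_loop k (A : 'M[R]_(k, (2 + d) * n + q))
  (B : 'M[R]_(k, (2 + d) * p + q)) (K : 'M[R]_(p, n)) (X : 'M[R]_n) :
  closed_loop A B K *m dsum ((1%:M : 'M[R]_(2 + d)) *t X) (1%:M : 'M[R]_q) =
  A *m dsum ((1%:M : 'M[R]_(2 + d)) *t X) (1%:M : 'M[R]_q) +
  B *m dsum ((1%:M : 'M[R]_(2 + d)) *t (K *m X)) (0 : 'M[R]_q).
Proof.
rewrite /closed_loop mulmxDl -mulmxA; congr (_ + _ *m _).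
rewrite /dsum mulmx_block !mul0mx !mulmx0 !addr0.
by rewrite tensmx_mul mul1mx.
Qed.

Lemma LMI_Sigma_closed_loop C1 C2 C3 D2 B4 B5 B6 (X : 'M[R]_n) (K : 'M[R]_(p, n)) :
  LMI_Sigma C1 C2 C3 D2 B4 B5 B6 X (K *m X) =
  closed_loop (row4 C1 C2 C3 D2) (row4 B4 B5 B6 (0 : 'M[R]_(m, q))) K
  *m dsum ((1%:M : 'M[R]_(2 + d)) *t X) (1%:M : 'M[R]_q).
Proof.
rewrite mul_closed_loop !mul_row4_dsum mul0mx mulmx1 /LMI_Sigma /row4.
rewrite add_row_mx addr0; congr row_mx.
by rewrite (add_row_mx (C1 *m X)) add_row_mx.
Qed.

(** The value of the main matrix inequality on a vector whose first block
    [a] satisfies [X a = Pi c]: this is exactly the kernel of the right factor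
    [[- X, Pi]] of the multiplier term, so the slack variables disappear and
    only the derivative of the functional and the supply rate remain. *)
Lemma bform_LMI_main r (f : R -> 'cV[R]_d) M alpha (X P : 'M[R]_n) (Q : 'M[R]_(n, d * n))
  (Rm : 'M[R]_(d * n)) (S U : 'M[R]_n) J1 Jt (J2 : 'M[R]_(m, q)) J3
  (Pi : 'M[R]_(n, (2 + d) * n + q)) (Sigma : 'M[R]_(m, (2 + d) * n + q))
  (a y1 y2 : 'cV[R]_n) (eta : 'cV[R]_(d * n)) (w : 'cV[R]_q) (zeta : 'cV[R]_m)
  (c := col4 y1 y2 eta w) (xi := col_mx a (col_mx c zeta))
  (deta := kroncol n (f 0) *m y1 - kroncol n (f (- r)) *m y2
           - (M *t (1%:M : 'M[R]_n)) *m eta) :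
  X *m a = Pi *m c ->
  bform (LMI_main alpha X (row_mx Pi 0) (LMI_P q m P Q)
          (LMI_Phi r f M Q Rm S U Sigma J1 Jt J2 J3)) xi xi =
  2 * (bform P a y1 + bform Q a eta + bform Q y1 deta + bform Rm eta deta)
  + bform (S + r *: U) y1 y1 - bform S y2 y2 - bform (sfF r f *t U) eta eta
  - bform J3 w w + bform J1 zeta zeta
  + 2 * (bform Jt zeta (Sigma *m c) - bform J2^T w (Sigma *m c)).
Proof.
move=> Xa; rewrite /LMI_main bformDl bform_Sy bformM.
have -> : row_mx (- X) (row_mx Pi (0 : 'M[R]_(n, m))) *m xi = 0.
  by rewrite /xi !mul_row_col mul0mx addr0 mulNmx Xa addNr.
rewrite [bform _ xi 0]/bform mulmx0 mxE mulr0 add0r /xi bform_block bform0l.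
rewrite bformT add0r {1 2}/LMI_P bform_row bform0l addr0 bform_row4 !bform0l.
rewrite /LMI_Phi bformDl [X in _ + (X + _)]bformDl !bform_Sy 2!bformM.
rewrite !mul_row_col !mul0mx !addr0.
rewrite !mulNmx [kroncol n (f 0) *m y1 + _]addrA -/deta.
rewrite 2!bform_dsum (bform_dsum (S + r *: U) _ y1 (col_mx y2 eta)) bform_dsum.
rewrite bform_col bform_col4 bform_col (bform_col 0 (- J2^T)) !bform0l !bformNl.
rewrite -/c; ring.
Qed.

End LMIEvaluation.

Section Dissipation.
Context {R : realType}.

(** [zeta = - J1^-1 Jt z] is the critical point of
    [zeta^T J1 zeta + 2 zeta^T Jt z]; the critical value is the part of the
    supply rate that is quadratic in [z], with the opposite sign. *)
Lemma supply_completion m q (J1 Jt : 'M[R]_m) (J2 : 'M[R]_(m, q)) J3 z w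
  (zeta := - (invmx J1 *m (Jt *m z))) : J1^T = J1 -> J1 \in unitmx ->
  bform J1 zeta zeta + 2 * (bform Jt zeta z - bform J2^T w z) - bform J3 w w =
  - supply J1 Jt J2 J3 z w.
Proof.
move=> J1s J1u; rewrite /supply -/(bform _ (col_mx z w) (col_mx z w)) bform_block.
rewrite -(bform1M Jt) /zeta !bformNr !bformNm opprK.
rewrite -(bform1M J1) mulKVmx //.
have -> : bform 1%:M (invmx J1 *m (Jt *m z)) (Jt *m z) =
          bform (Jt^T *m invmx J1 *m Jt) z z.
  by rewrite !bform_mull !bformM mulmx1 trmx_inv J1s.
rewrite bformT; ring.
Qed.

(** The left side is the derivative of the Krasovskii functional minus the supply
    rate, with [int y^T U y] replaced by its Bessel lower bound; the quadratic
    form of the main inequality takes this value at the vector built from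
    [a], the rescaled state [dsum (1 *t X^-1) 1 chi] and the critical [zeta].
    Definiteness of the whole form then gives a margin in [y1] and [eta]. *)
Lemma LMI_dissipation n p q m d r (f : R -> 'cV[R]_d) M alpha
  (A1 A2 : 'M[R]_n) (A3 : 'M[R]_(n, d * n))
  (B1 B2 : 'M[R]_(n, p)) (B3 : 'M[R]_(n, d * p)) (D1 : 'M[R]_(n, q))
  (C1 C2 : 'M[R]_(m, n)) (C3 : 'M[R]_(m, d * n))
  (B4 B5 : 'M[R]_(m, p)) (B6 : 'M[R]_(m, d * p)) (D2 : 'M[R]_(m, q))
  (J1 Jt : 'M[R]_m) (J2 : 'M[R]_(m, q)) (J3 : 'M[R]_q)
  (P X S U : 'M[R]_n) (V : 'M[R]_(p, n)) (Q : 'M[R]_(n, d * n)) (Rm : 'M[R]_(d * n))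
  (bA := row4 A1 A2 A3 D1) (bB1 := row4 B1 B2 B3 (0 : 'M[R]_(n, q)))
  (bC := row4 C1 C2 C3 D2) (bB2 := row4 B4 B5 B6 (0 : 'M[R]_(m, q)))
  (K := V *m invmx X) :
  J1^T = J1 -> J1 \in unitmx ->
  negdefmx (LMI_main alpha X (LMI_Pi m bA bB1 X V) (LMI_P q m P Q)
    (LMI_Phi r f M Q Rm S U (LMI_Sigma C1 C2 C3 D2 B4 B5 B6 X V) J1 Jt J2 J3)) ->
  X \in unitmx /\ exists2 e : R, 0 < e & 
      forall x1 x2 x3 w (chi := col4 x1 x2 x3 w)
    (a := invmx X *m (closed_loop bA bB1 K *m chi))
    (y1 := invmx X *m x1) (y2 := invmx X *m x2)
    (eta := ((1%:M : 'M[R]_d) *t invmx X) *m x3)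
    (deta := kroncol n (f 0) *m y1 - kroncol n (f (- r)) *m y2
             - (M *t (1%:M : 'M[R]_n)) *m eta),
    2 * (bform P a y1 + bform Q a eta + bform Q y1 deta + bform Rm eta deta)
    + bform (S + r *: U) y1 y1 - bform S y2 y2 - bform (sfF r f *t U) eta eta
    - supply J1 Jt J2 J3 (closed_loop bC bB2 K *m chi) w
    <= - e * (sqn y1 + sqn eta).
Proof.
move=> J1s J1u nd.
have uX : X \in unitmx.
  (* the top left block of the main matrix is [- Sy X] *)
  apply: unitmx_Sy_posdef; split.
    by rewrite /Sy raddfD /= trmxK addrC.
  move=> u u0; have v0 : col_mx u 0 != 0 :> 'cV_(n + ((2 + d) * n + q + m)).
    by rewrite col_mx_eq0 negb_and u0.
  have := posdef_gt0 nd v0; rewrite -/(bform _ u u) bform_Sy bformNl.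
  rewrite /LMI_main bformDl bform_Sy bformM bform_block.
  rewrite mul_row_col mulmx0 addr0 /LMI_multiplier bform_col.
  rewrite !bform0l mulNmx !bformNr bform1M.
  have z0 a (B : 'M[R]_(n, a)) : bform B u 0 = 0 by rewrite /bform mulmx0 mxE.
  have z1 a b (B : 'M[R]_(a, b)) v : bform B 0 v = 0.
    by rewrite -bformT /bform mulmx0 mxE.
  by rewrite z0 !z1 !addr0 oppr0 addr0 mulrN opprK.
split=> //.
have [e e0 he] := posdef_coercive nd.
exists e; first exact: e0.
move=> x1 x2 x3 w; cbv zeta; set chi := col4 x1 x2 x3 w.
set a := invmx X *m (closed_loop bA bB1 K *m chi).
set y1 := invmx X *m x1; set y2 := invmx X *m x2.
set eta := _ *t _ *m x3; set deta := _ - M *t 1%:M *m eta.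
pose c := col4 y1 y2 eta w.
pose z := closed_loop bC bB2 K *m chi.
pose zeta := - (invmx J1 *m (Jt *m z)).
have VE : V = K *m X by rewrite mulmxKV.
have cE : dsum ((1%:M : 'M[R]_(2 + d)) *t X) (1%:M : 'M[R]_q) *m c = chi.
  rewrite mul_dsum_col4 !mulKVmx // mul1mx mulmxA tensmx_mul mul1mx mulmxV //.
  congr col4; rewrite (_ : 1%:M *t 1%:M = 1%:M) ?mul1mx //.
  apply/matrixP => i j; rewrite !mxE -natrM mulnb; congr (_ %:R); congr nat_of_bool.
  rewrite -[i in RHS]mxtens_unindexK -[j in RHS]mxtens_unindexK.
  rewrite (can_eq (@mxtens_indexK _ _)).
  by case: (mxtens_unindex i) => ? ?; case: (mxtens_unindex j).
have PiE : bA *m dsum ((1%:M : 'M[R]_(2 + d)) *t X) (1%:M : 'M[R]_q)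
          + bB1 *m dsum ((1%:M : 'M[R]_(2 + d)) *t V) (0 : 'M[R]_q)
        = closed_loop bA bB1 K *m dsum ((1%:M : 'M[R]_(2 + d)) *t X) 1%:M.
  by rewrite mul_closed_loop -VE.
have := he (col_mx a (col_mx c zeta)).
rewrite bformNl /LMI_Pi PiE bform_LMI_main; last first.
  by rewrite -mulmxA cE mulKVmx.
have SigE : LMI_Sigma C1 C2 C3 D2 B4 B5 B6 X V *m c = z.
  have -> W : W = K *m X -> LMI_Sigma C1 C2 C3 D2 B4 B5 B6 X W *m c = z => //.
  by move=> ->; rewrite LMI_Sigma_closed_loop -mulmxA cE.
rewrite -/deta -/c SigE !sqn_col => {}he.
have sE := supply_completion Jt J2 J3 z w J1s J1u; rewrite -/zeta in sE.
have s0 : 0 <= e * (sqn a + (sqn y2 + sqn w) + sqn zeta).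
  by rewrite mulr_ge0 ?(ltW e0) ?addr_ge0 ?sqn_ge0.
rewrite -/z; move: he sE s0.
lra.
Qed.

End Dissipation.

(** * Integrals of continuous matrix functions and Bessel's inequality *)

Section WithinContinuity.
Context {R : realType}.
Variable D : set R.

Lemma within_contM (g h : R -> R) :
  {within D, continuous g} -> {within D, continuous h} ->
  {within D, continuous (fun t => g t * h t)}.
Proof. by move=> cg ch x; apply: continuousM; [exact: cg|exact: ch]. Qed.

Lemma within_cont_eq (g h : R -> R) : g =1 h ->
  {within D, continuous g} -> {within D, continuous h}.
Proof. by move=> /funext ->. Qed.

Lemma within_cont_cst (c : R) : {within D, continuous (fun=> c)}.
Proof. by move=> x; exact: cvg_cst. Qed.

Lemma within_cont_sum (I : Type) (s : seq I) (F : I -> R -> R) :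
  (forall i, {within D, continuous (F i)}) ->
  {within D, continuous (fun t => \sum_(i <- s) F i t)}.
Proof.
move=> cF; elim: s => [|i s IH].
  apply: (@within_cont_eq (fun=> 0)) => [t|]; first by rewrite big_nil.
  exact: within_cont_cst.
apply: (@within_cont_eq (fun t => F i t + \sum_(j <- s) F j t)) => [t|].
  by rewrite big_cons.
exact: within_continuousD.
Qed.

Lemma within_cont_coord k l (G : R -> 'M[R]_(k, l)) i j :
  {within D, continuous G} -> {within D, continuous (fun t => G t i j)}.
Proof.
move=> cG x; apply: (@continuous_comp (subspace D) _ _ G (fun M => M i j) x).
  exact: cG.
exact: coord_continuous.
Qed.

Lemma within_contP (g : R -> R) : {within D, continuous g} <->
  forall t e : R, D t -> 0 < e -> exists2 d : R, 0 < d &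
    forall s : R, D s -> `|s - t| < d -> `|g s - g t| <= e.
Proof.
split=> [/subspace_continuousP cg t e Dt e0|H].
  have /cvgrPdist_le/(_ e e0)[d /= d0 hd] := cg t Dt.
  by exists d => // s Ds st; rewrite distrC; apply: hd => //; rewrite /ball /= distrC.
apply/subspace_continuousP => t Dt; apply/cvgrPdist_le => e e0.
have [d d0 hd] := H t e Dt e0; exists d => //= s; rewrite /ball /= distrC => st Ds.
by rewrite distrC; exact: hd.
Qed.

End WithinContinuity.

Section MatrixIntegral.
Context {R : realType}.
Variables (a b : R).
Let D : set R := `[a, b]%classic.
Let mu := @lebesgue_measure R.

Let mD : measurable D. Proof. exact: measurable_itv. Qed.

Definition mxcont k l (G : R -> 'M[R]_(k, l)) : Prop :=
  forall i j, {within `[a, b]%classic, continuous (fun t => G t i j)}.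

Lemma mxcont_cst k l (A : 'M[R]_(k, l)) : mxcont (fun=> A).
Proof. by move=> i j; exact: within_cont_cst. Qed.

Lemma mxcontD k l (G H : R -> 'M[R]_(k, l)) :
  mxcont G -> mxcont H -> mxcont (fun t => G t + H t).
Proof.
move=> cG cH i j; apply: (@within_cont_eq _ _ (fun t => G t i j + H t i j)) => [t|].
  by rewrite mxE.
exact: within_continuousD.
Qed.

Lemma mxcontN k l (G : R -> 'M[R]_(k, l)) : mxcont G -> mxcont (fun t => - G t).
Proof.
move=> cG i j; apply: (@within_cont_eq _ _ (fun t => - G t i j)) => [t|x].
  by rewrite mxE.
exact/continuousN/cG.
Qed.

Lemma mxcontM k l o (G : R -> 'M[R]_(k, l)) (H : R -> 'M[R]_(l, o)) :
  mxcont G -> mxcont H -> mxcont (fun t => G t *m H t).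
Proof.
move=> cG cH i j.
apply: (@within_cont_eq _ _ (fun t => \sum_s G t i s * H t s j)) => [t|].
  by rewrite mxE.
by apply: within_cont_sum => s; exact: within_contM.
Qed.

Lemma mxcontZ k l (c : R -> R) (G : R -> 'M[R]_(k, l)) :
  {within D, continuous c} -> mxcont G -> mxcont (fun t => c t *: G t).
Proof.
move=> cc cG i j; apply: (@within_cont_eq _ _ (fun t => c t * G t i j)) => [t|].
  by rewrite mxE.
exact: within_contM.
Qed.

Lemma mxcont_tr k l (G : R -> 'M[R]_(k, l)) : mxcont G -> mxcont (fun t => (G t)^T).
Proof.
by move=> cG i j; apply: within_cont_eq (cG j i) => t; rewrite mxE.
Qed.

Lemma mxcont_within k l (G : R -> 'M[R]_(k, l)) :
  {within D, continuous G} -> mxcont G.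
Proof.
by move=> cG i j; exact: within_cont_coord.
Qed.

Lemma within_cont_bounded (g : R -> R) : {within D, continuous g} ->
  exists2 M : R, 0 <= M & forall s, a <= s <= b -> `|g s| <= M.
Proof.
move=> cg; have := continuous_compact cg (@segment_compact R a b).
move=> /compact_bounded[M [Mr HM]]; exists (`|M| + 1); first by rewrite addr_ge0.
move=> s sr; apply: (HM (`|M| + 1)); first by have := ler_norm M; lra.
by exists s => //=; rewrite in_itv.
Qed.

Lemma within_cont_integrable (g : R -> R) :
  {within D, continuous g} -> mu.-integrable D (EFin \o g).
Proof. by move=> cg; apply: continuous_compact_integrable; first exact: segment_compact. Qed.

Lemma Rint_sum (I : Type) (s : seq I) (F : I -> R -> R) :
  (forall i, {within D, continuous (F i)}) ->
  \int[mu]_(t in D) (\sum_(i <- s) F i t) = \sum_(i <- s) \int[mu]_(t in D) F i t.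
Proof.
move=> cF; elim: s => [|i s IH].
  rewrite big_nil; transitivity (\int[mu]_(t in D) (0 : R)).
    by apply: eq_Rintegral => t _; rewrite big_nil.
  by rewrite Rintegral_cst ?mul0r //; exact: mD.
rewrite big_cons -IH -RintegralD.
- by apply: eq_Rintegral => t _; rewrite big_cons.
- exact: mD.
- exact: within_cont_integrable.
- by apply: within_cont_integrable; exact: within_cont_sum.
Qed.

Lemma Rint_bound (g : R -> R) M : a <= b -> {within D, continuous g} ->
  (forall t, D t -> `|g t| <= M) -> `|\int[mu]_(t in D) g t| <= M * (b - a).
Proof.
move=> ab cg gM; have ig := within_cont_integrable cg.
apply: le_trans (le_normr_Rintegral _ ig) _ => //.
have -> : M * (b - a) = \int[mu]_(t in D) M.
  rewrite Rintegral_cst //= /mu /D lebesgue_measure_itv /= lte_fin.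
  by case: (ltgtP a b) ab => // -> _; rewrite subrr.
apply: le_Rintegral => //.
- apply: within_cont_integrable => x.
  apply: (@continuous_comp (subspace D) _ _ g (@Num.norm R R) x); first exact: cg.
  exact: norm_continuous.
- by apply: within_cont_integrable; exact: within_cont_cst.
Qed.

Lemma mxintD k l (G H : R -> 'M[R]_(k, l)) : mxcont G -> mxcont H ->
  mxint D (fun t => G t + H t) = mxint D G + mxint D H.
Proof.
move=> cG cH; apply/matrixP => i j; rewrite !mxE.
rewrite -RintegralD; first by apply: eq_Rintegral => t _; rewrite mxE.
- exact: mD.
- exact: within_cont_integrable.
- exact: within_cont_integrable.
Qed.

Lemma mxintMl k l o (A : 'M[R]_(k, l)) (G : R -> 'M[R]_(l, o)) : mxcont G ->
  mxint D (fun t => A *m G t) = A *m mxint D G.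
Proof.
move=> cG; apply/matrixP => i j; rewrite !mxE.
transitivity (\int[mu]_(t in D) \sum_s A i s * G t s j).
  by apply: eq_Rintegral => t _; rewrite mxE.
rewrite Rint_sum => [|s]; last by apply: within_contM; [exact: within_cont_cst|].
apply: eq_bigr => s _; rewrite mxE RintegralZl.
- by [].
- exact: mD.
- exact: within_cont_integrable.
Qed.

Lemma mxint_tr k l (G : R -> 'M[R]_(k, l)) :
  mxint D (fun t => (G t)^T) = (mxint D G)^T.
Proof.
by apply/matrixP => i j; rewrite !mxE; apply: eq_Rintegral => t _; rewrite mxE.
Qed.

Lemma eq_mxint k l (G H : R -> 'M[R]_(k, l)) :
  (forall t, a <= t <= b -> G t = H t) -> mxint D G = mxint D H.
Proof.
move=> GH; apply/matrixP => i j; rewrite !mxE; apply: eq_Rintegral => t.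
by rewrite inE /D /= in_itv /= => /GH ->.
Qed.

Lemma mxintMr k l o (A : 'M[R]_(l, o)) (G : R -> 'M[R]_(k, l)) : mxcont G ->
  mxint D (fun t => G t *m A) = mxint D G *m A.
Proof.
move=> cG; apply: trmx_inj; rewrite -mxint_tr trmx_mul -mxint_tr -mxintMl.
  by apply: eq_mxint => t _; rewrite trmx_mul.
exact: mxcont_tr.
Qed.

Lemma mxintN k l (G : R -> 'M[R]_(k, l)) : mxcont G ->
  mxint D (fun t => - G t) = - mxint D G.
Proof.
move=> cG; rewrite -scaleN1r -mul_scalar_mx -mxintMl //.
by apply: eq_mxint => t _; rewrite mul_scalar_mx scaleN1r.
Qed.

Lemma mxintB k l (G H : R -> 'M[R]_(k, l)) : mxcont G -> mxcont H ->
  mxint D (fun t => G t - H t) = mxint D G - mxint D H.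
Proof. by move=> cG cH; rewrite mxintD ?mxintN //; exact: mxcontN. Qed.

Lemma mxint_trace k l (A : 'M[R]_(k, l)) (G : R -> 'M[R]_(l, k)) : mxcont G ->
  \tr (A *m mxint D G) = \int[mu]_(t in D) \tr (A *m G t).
Proof.
move=> cG; rewrite -mxintMl // /mxtrace.
have cAG i : {within D, continuous (fun t => (A *m G t) i i)}.
  by have := mxcontM (@mxcont_cst _ _ A) cG => /(_ i i).
by rewrite Rint_sum //; apply: eq_bigr => i _; rewrite mxE.
Qed.

Lemma trace_outer k l (A : 'M[R]_(k, l)) (u : 'cV[R]_l) (v : 'cV[R]_k) :
  \tr (A *m (u *m v^T)) = bform A v u.
Proof. by rewrite mulmxA mxtrace_mulC mulmxA /bform /mxtrace big_ord1. Qed.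

(** [int y y^T - H G^-1 H^T] is the Gram matrix [int w w^T] of the residual
    [w = y - H G^-1 f] of the orthogonal projection of [y] on the span of [f],
    since [int w f^T = 0]; so its trace against [U] is nonnegative. *)
Lemma matrix_Bessel n d (f : R -> 'cV[R]_d) (y : R -> 'cV[R]_n) (U : 'M[R]_n)
  (G := mxint D (fun t => f t *m (f t)^T))
  (H := mxint D (fun t => y t *m (f t)^T)) :
  mxcont f -> mxcont y -> posdefmx G -> (forall u, 0 <= bform U u u) ->
  bform (invmx G *t U) (cvec H) (cvec H) <=
  \tr (U *m mxint D (fun t => y t *m (y t)^T)).
Proof.
move=> cf cy pG pU; have uG := posdef_unitmx pG.
pose C := H *m invmx G; pose w t := y t - C *m f t.
have cCf : mxcont (fun t => C *m f t) by apply: mxcontM => //; exact: mxcont_cst.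
have cw : mxcont w by apply: mxcontD => //; exact: mxcontN.
have cfT := mxcont_tr cf; have cyT := mxcont_tr cy.
have wf0 : mxint D (fun t => w t *m (f t)^T) = 0.
  transitivity (mxint D (fun t => y t *m (f t)^T - C *m (f t *m (f t)^T))).
    by apply: eq_mxint => t _; rewrite /w mulmxBl mulmxA.
  rewrite mxintB ?mxintMl -/G -/H ?mulmxKV ?subrr //; try exact: mxcontM.
  by apply/mxcontM/mxcontM => //; exact: mxcont_cst.
have wE : mxint D (fun t => w t *m (w t)^T) =
    mxint D (fun t => y t *m (y t)^T) - C *m H^T.
  transitivity (mxint D (fun t => w t *m (y t)^T - w t *m (f t)^T *m C^T)).
    by apply: eq_mxint => t _; rewrite {2}/w raddfB /= trmx_mul mulmxBr mulmxA.
  rewrite mxintB ?mxintMr ?wf0 ?mul0mx ?subr0; try exact: mxcontM; last first.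
    by apply/mxcontM/mxcont_cst/mxcontM.
  transitivity (mxint D (fun t => y t *m (y t)^T - C *m (f t *m (y t)^T))).
    by apply: eq_mxint => t _; rewrite /w mulmxBl mulmxA.
  rewrite mxintB ?mxintMl; try exact: mxcontM; last first.
    by apply/mxcontM/mxcontM => //; exact: mxcont_cst.
  congr (_ - _ *m _); rewrite -mxint_tr; apply: eq_mxint => t _.
  by rewrite trmx_mul trmxK.
have : 0 <= \tr (U *m mxint D (fun t => w t *m (w t)^T)).
  rewrite mxint_trace; last by apply: mxcontM => //; exact: mxcont_tr.
  by apply: Rintegral_ge0 => t _; rewrite trace_outer.
rewrite wE mulmxBr raddfB /= subr_ge0 bform_tens_cvec /C trmx_inv (posdef_sym pG).
congr (_ <= _); rewrite -mulmxA mxtrace_mulC !mulmxA mxtrace_mulC.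
by rewrite !mulmxA mxtrace_mulC !mulmxA.
Qed.

End MatrixIntegral.

(** * Derivatives within a set *)

Section WithinDerivative.
Context {R : realType}.

Lemma norm_coord k l (A : 'M[R]_(k, l)) i j : `|A i j| <= `|A|.
Proof.
rewrite [X in _ <= X]/Num.norm /= mx_normE -[leLHS]nngE num_le.
exact: (le_bigmax _ (fun p : 'I_k * 'I_l => `|A p.1 p.2|%:nng) (i, j)).
Qed.

Lemma norm_le_coord k l (A : 'M[R]_(k, l)) (c : R) : 0 <= c ->
  (forall i j, `|A i j| <= c) -> `|A| <= c.
Proof.
move=> c0 Ac; rewrite [X in X <= _]/Num.norm /= mx_normE.
rewrite -[c]/((NngNum c0)%:num) num_le; apply/bigmax_leP; split=> [|[i j] _].
  by rewrite -num_le.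
by rewrite -num_le /=.
Qed.

Lemma is_derive_withinP (V : normedModType R) (D : set R) (g : R -> V) t l :
  is_derive_within D g t l <->
  forall e : R, 0 < e -> exists2 dl : R, 0 < dl & forall s, D s -> `|s - t| < dl ->
    `|g s - g t - (s - t) *: l| <= e * `|s - t|.
Proof.
split=> [/cvgrPdist_le h e e0|h].
  have [dl /= dl0 hdl] := h e e0.
  exists dl => // s Ds st; have [->|sNt] := eqVneq s t.
    by rewrite !subrr scale0r subr0 !normr0 mulr0.
  have /= := hdl s; rewrite /ball /= distrC => /(_ st sNt Ds).
  have st0 : s - t != 0 by rewrite subr_eq0.
  have -> : l - (s - t)^-1 *: (g s - g t)
    = - ((s - t)^-1 *: (g s - g t - (s - t) *: l)).
    by rewrite [in RHS]scalerBr scalerA mulVf // scale1r opprB.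
  by rewrite normrN normrZ normfV mulrC ler_pdivrMr ?normr_gt0.
apply/cvgrPdist_le => e e0.
have [dl dl0 hdl] := h e e0; exists dl => //= s; rewrite /ball /= distrC => st sNt Ds.
have st0 : s - t != 0 by rewrite subr_eq0.
have -> : l - (s - t)^-1 *: (g s - g t)
    = - ((s - t)^-1 *: (g s - g t - (s - t) *: l)).
  by rewrite [in RHS]scalerBr scalerA mulVf // scale1r opprB.
by rewrite normrN normrZ normfV mulrC ler_pdivrMr ?normr_gt0 //; exact: hdl.
Qed.

(** Fixing the codomain to [R^o] lets one write products of functions. *)
Definition dwithin (D : set R) (g : R -> R) (t l : R) :=
  is_derive_within (V := R^o) D g t l.

Implicit Types (D : set R) (g h : R -> R).

Lemma dwithin_coord k D (x : R -> 'cV[R]_k) t l i :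
  is_derive_within D x t l -> dwithin D (fun s => x s i 0) t (l i 0).
Proof.
move=> /is_derive_withinP h; apply/is_derive_withinP => e /h[dl dl0 hdl].
exists dl => // s Ds /(hdl s Ds); apply: le_trans.
by have := norm_coord (x s - x t - (s - t) *: l) i 0; rewrite !mxE.
Qed.

Lemma dwithin_subset D D' g t l : D' `<=` D -> dwithin D g t l -> dwithin D' g t l.
Proof.
move=> DD' /is_derive_withinP h; apply/is_derive_withinP => e /h[dl dl0 hdl].
by exists dl => // s /DD' Ds; exact: hdl.
Qed.

Lemma eq_dwithin D g h t l : D t -> (forall s, D s -> g s = h s) ->
  dwithin D g t l -> dwithin D h t l.
Proof.
move=> Dt gh /is_derive_withinP H; apply/is_derive_withinP => e /H[dl dl0 hdl].
by exists dl => // s Ds; rewrite -!gh //; exact: hdl.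
Qed.

Lemma eq_near_dwithin D g h t l d : 0 < d -> (forall s, `|s - t| < d -> g s = h s) ->
  dwithin D g t l -> dwithin D h t l.
Proof.
move=> d0 gh /is_derive_withinP H; apply/is_derive_withinP => e /H[dl dl0 hdl].
exists (Num.min d dl); first by rewrite lt_min d0.
move=> s Ds; rewrite lt_min => /andP[sd sdl]; rewrite -!gh ?subrr ?normr0 //.
exact: hdl.
Qed.

Lemma dwithin_cst D (c : R) t : dwithin D (fun=> c) t 0.
Proof.
apply/is_derive_withinP => e e0; exists 1 => // s _ _.
by rewrite !subrr scaler0 subr0 normr0 mulr_ge0 // ltW.
Qed.

Lemma dwithin_cvg D g t l : dwithin D g t l -> g s @[s --> within D t^'] --> g t.
Proof.
move=> dg; apply/cvgrPdist_le => e e0.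
have /is_derive_withinP/(_ _ ltr01)[dl dl0 hdl] := dg.
pose c := `|l| + 1; have c0 : 0 < c by rewrite /c; have := normr_ge0 l; lra.
exists (Num.min dl (e / c)); first by rewrite /= lt_min dl0 divr_gt0.
move=> s /=; rewrite distrC lt_min => /andP[s1 s2] sNt Ds.
have := hdl s Ds s1; rewrite mul1r => h.
have s3 : `|s - t| * c < e by rewrite -ltr_pdivlMr.
rewrite distrC; have -> : g s - g t = (g s - g t - (s - t) *: (l : R^o)) + (s - t) * l.
  by rewrite subrK.
rewrite (le_trans (ler_normD _ _)) // normrM.
apply: (le_trans (lerD h (lexx _))); apply: le_trans (ltW s3).
by rewrite /c mulrDr mulr1 addrC.
Qed.

Lemma dwithinD D g h t l k : dwithin D g t l -> dwithin D h t k ->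
  dwithin D (fun s => g s + h s) t (l + k).
Proof.
rewrite /dwithin /is_derive_within => dg dh.
rewrite (_ : (fun s => _) = (fun s => (s - t)^-1 *: (g s - g t : R^o))
                        \+ (fun s => (s - t)^-1 *: (h s - h t : R^o))).
  exact: cvgD.
by apply/funext => s; rewrite /= -scalerDr opprD addrACA.
Qed.

Lemma dwithinM D g h t l k : dwithin D g t l -> dwithin D h t k ->
  dwithin D (fun s => g s * h s) t (l * h t + g t * k).
Proof.
move=> dg dh; have ch := dwithin_cvg dh; rewrite /dwithin /is_derive_within.
rewrite (_ : (fun s => _) =
    (fun s => ((s - t)^-1 *: (g s - g t : R^o)) * h s)
    \+ (fun s => g t * ((s - t)^-1 *: (h s - h t : R^o)))).
  by apply: cvgD; [exact: (cvgM dg ch)|exact: (cvgM (cvg_cst (g t)) dh)].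
apply/funext => s; rewrite /= /GRing.scale /=; ring.
Qed.

Lemma dwithinZ D (c : R) g t l : dwithin D g t l ->
  dwithin D (fun s => c * g s) t (c * l).
Proof.
by move=> dg; have := dwithinM (dwithin_cst D c t) dg; rewrite mul0r add0r.
Qed.

Lemma dwithin_sum (I : Type) (s : seq I) D (F : I -> R -> R) (l : I -> R) t :
  (forall i, dwithin D (F i) t (l i)) ->
  dwithin D (fun u => \sum_(i <- s) F i u) t (\sum_(i <- s) l i).
Proof.
move=> dF; elim: s => [|i s IH].
  rewrite big_nil (_ : (fun _ => _) = fun=> 0); last first.
    by apply/funext => u; rewrite big_nil.
  exact: dwithin_cst.
rewrite big_cons (_ : (fun _ => _) = fun u => F i u + \sum_(j <- s) F j u).
  exact: dwithinD.
by apply/funext => u; rewrite big_cons.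
Qed.

Lemma is_derive_dwithin D g (t l : R) : is_derive t 1 g l -> dwithin D g t l.
Proof.
case=> dg lE; apply: (@dwithin_subset setT) => //.
have /cvgrPdist_le H :
    h^-1 *: ((g \o shift t) (h *: 1) - g t) @[h --> (0 : R)^'] --> (l : R^o).
  by rewrite -lE; exact: dg.
apply/is_derive_withinP => e e0; have [dl dl0 hdl] := H e e0.
exists dl => // s _ st; have [->|sNt] := eqVneq s t.
  by rewrite !subrr scale0r subr0 !normr0 mulr0.
have st0 : s - t != 0 by rewrite subr_eq0.
have /= := hdl (s - t); rewrite /ball /= sub0r normrN => /(_ st st0).
have -> : l - (s - t)^-1 *: ((g \o shift t) ((s - t) *: 1) - g t)
    = - ((s - t)^-1 *: (g s - g t - (s - t) *: (l : R^o))).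
  rewrite [in RHS]scalerBr scalerA mulVf // scale1r opprB /=.
  by rewrite /GRing.scale /= mulr1 subrK.
by rewrite normrN normrZ normfV mulrC ler_pdivrMr ?normr_gt0.
Qed.

Lemma dwithin_is_derive D g (t l : R) : nbhs t D -> dwithin D g t l ->
  is_derive t 1 g l.
Proof.
move=> [d0 /= d00 Dd] /is_derive_withinP H.
have cv : h^-1 *: ((g \o shift t) (h *: 1) - g t) @[h --> (0:R)^'] --> (l : R^o).
  apply/cvgrPdist_le => e e0; have [dl dl0 hdl] := H e e0.
  exists (Num.min d0 dl); first by rewrite /= lt_min d00.
  move=> h /=; rewrite sub0r normrN lt_min => /andP[h1 h2] h0.
  have Ds : D (h + t) by apply: Dd; rewrite /ball /= opprD addrC subrK normrN.
  have := hdl _ Ds; rewrite addrK => /(_ h2).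
  have -> : l - h^-1 *: (g (h *: 1 + t) - g t)
      = - (h^-1 *: (g (h + t) - g t - h *: (l : R^o))).
    rewrite [in RHS]scalerBr scalerA mulVf // scale1r opprB /=.
    by rewrite /GRing.scale /= mulr1.
  by move=> hle; rewrite normrN normrZ normfV mulrC ler_pdivrMr ?normr_gt0.
split; first by apply/cvg_ex; exists l.
exact/cvg_lim.
Qed.

End WithinDerivative.

(** * Differentiating an integral over a sliding window *)

Section SlidingWindow.
Context {R : realType}.
Let mu := @lebesgue_measure R.

Lemma antiderivative (g : R -> R) (A : R) : continuous g ->
  exists G : R -> R, forall u, A < u -> is_derive u 1 G (g u).
Proof.
move=> cg; exists (fun u => \int[mu]_(t in `[A, u]) g t) => u Au.
have uu : u < u + 1 by rewrite ltrDl.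
have ig : mu.-integrable `[A, u + 1] (EFin \o g).
  apply: continuous_compact_integrable; first exact: segment_compact.
  exact: continuous_subspaceT.
have [dG GE] := continuous_FTC1_closed uu ig Au (cg u).
by split; [exact: dG|rewrite -derive1E].
Qed.

Lemma is_derive_shift (G : R -> R) (c u l : R) :
  is_derive (u + c) 1 G l -> is_derive u 1 (fun s => G (s + c)) l.
Proof.
move=> dG; have d1 : is_derive u 1 (fun s : R => s + c) 1.
  by have := is_deriveD (is_derive_id u 1) (is_derive_cst c u 1); rewrite addr0.
by have := @is_derive1_comp R G (fun s : R => s + c) u _ _ dG d1; rewrite mulr1.
Qed.

(** Integrating by parts moves the derivative from [k] to an antiderivative [G]
    of [g].  The result only involves values of [G] and the integral of
    [k' s * G (v + s)], and these can be differentiated in [v] although [g] is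
    merely continuous. *)
Lemma window_derive (r t : R) (k k' g : R -> R)
  (h := fun t => \int[mu]_(s in `[- r, 0]) (k s * g (t + s))) :
  0 < r -> {within `[- r, 0], continuous k'} ->
  derivable_oo_LRcontinuous k (- r) 0 -> {in `]- r, 0[, derive1 k =1 k'} ->
  continuous g ->
  dwithin setT h t
    (k 0 * g t - k (- r) * g (t - r) - \int[mu]_(s in `[- r, 0]) (k' s * g (t + s))).
Proof.
move=> r0 ck' dk kE cg.
(* the base point lies to the left of every window used near [t] *)
have [G GE] := antiderivative (t - r - 2) cg.
have GEs (v s : R) : t - 2 < v -> - r <= s -> is_derive v 1 (fun v => G (v + s)) (g (v + s)).
  by move=> vt sr; apply: is_derive_shift; apply: GE; lra.
have GEs' (v s : R) : t - 2 < v -> - r <= s -> is_derive s 1 (fun s => G (v + s)) (g (v + s)).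
  move=> vt sr; have -> : (fun s => G (v + s)) = (fun s => G (s + v)).
    by apply/funext => u; rewrite addrC.
  by rewrite [v + s]addrC; apply: is_derive_shift; apply: GE; lra.
have cgv (v : R) : continuous (fun s => g (v + s)).
  move=> s; apply: (@continuous_comp _ _ _ (fun s => v + s) g); last exact: cg.
  by apply: cvgD; [exact: cvg_cst|exact: cvg_id].
have cGv (v : R) : t - 2 < v -> {within `[- r, 0], continuous (fun s => G (v + s))}.
  move=> vt; apply: continuous_in_subspaceT => s; rewrite inE /= in_itv /= => /andP[s1 s2].
  have [ds _] := GEs' v s vt s1.
  exact/differentiable_continuous/derivable1_diffP.
have cM (p q : R -> R) : {within `[- r, 0], continuous p} ->
    {within `[- r, 0], continuous q} ->
    {within `[- r, 0], continuous (fun s => p s * q s)}.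
  by move=> cp cq; exact: within_contM.
have byparts (v : R) : t - 2 < v -> h v = k 0 * G v - k (- r) * G (v - r)
    - \int[mu]_(s in `[- r, 0]) (k' s * G (v + s)).
  move=> vt; rewrite /h (@Rintegration_by_parts R k (fun s => G (v + s)) k'
     (fun s => g (v + s)) (- r) 0) ?addr0 //; first lra.
  - exact: continuous_subspaceT.
  - have cs s : - r <= s -> {for s, continuous (fun s => G (v + s))}.
      move=> sr; have [ds _] := GEs' v s vt sr.
      exact/differentiable_continuous/derivable1_diffP.
    split.
    + move=> s; rewrite in_itv /= => /andP[s1 _].
      by have [] := GEs' v s vt (ltW s1).
    + by apply: cvg_at_right_filter; apply: cs.
    + by apply: cvg_at_left_filter; apply: cs; lra.
  - move=> s; rewrite in_itv /= => /andP[s1 _].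
    by rewrite derive1E; have [_ ->] := GEs' v s vt (ltW s1).
apply: (@eq_near_dwithin _ _ (fun v => (k 0 * G v + - 1 * (k (- r) * G (v - r)))
    + - 1 * \int[mu]_(s in `[- r, 0]) (k' s * G (v + s))) _ _ _ 1) => //.
  move=> v; rewrite ltr_norml => /andP[v1 v2]; rewrite byparts ?mulN1r //; lra.
rewrite -[- (_ * g (t - r))]mulN1r -[- Rintegral _ _ _]mulN1r.
apply: dwithinD; first apply: dwithinD.
- apply/dwithinZ/is_derive_dwithin; apply: GE; lra.
- by apply/dwithinZ/dwithinZ/is_derive_dwithin; apply: GEs; lra.
apply: dwithinZ.
have [M Mr kM] := within_cont_bounded ck'.
have [N Nr gN] := @within_cont_bounded R (t - r - 1) (t + 1) g (continuous_subspaceT cg).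
pose F (v s : R) : R := k' s * G (v + s).
have dF (v s : R) : t - 1 < v -> - r <= s -> is_derive v 1 (F ^~ s) (k' s * g (v + s)).
  move=> v1 s1; have dG : is_derive v 1 (fun v => G (v + s)) (g (v + s)).
    by apply: GEs => //; lra.
  exact: is_deriveZ.
have winI (v s : R) : t - 1 < v -> v < t + 1 -> - r <= s -> s <= 0 ->
    t - r - 1 <= v + s <= t + 1 by clear; lra.
have tI : `]t - 1, t + 1[%classic t by rewrite /= in_itv /=; lra.
have mB : measurable (`[- r, 0]%classic : set (measurableTypeR R)).
  exact: measurable_itv.
have iF (v : R) : `]t - 1, t + 1[%classic v -> mu.-integrable `[- r, 0] (EFin \o F v).
  rewrite /= in_itv /= => /andP[v1 v2]; apply: within_cont_integrable.
  by apply: cM => //; apply: cGv; lra.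
have dF1 (v s : R) : `]t - 1, t + 1[%classic v -> `[- r, 0]%classic s ->
    derivable (F ^~ s) v 1.
  rewrite /= !in_itv /= => /andP[v1 v2] /andP[s1 s2].
  by have [] := dF v s v1 s1.
have dFE (v s : R) : t - 1 < v -> - r <= s -> partial1of2 F v s = k' s * g (v + s).
  by move=> v1 s1; rewrite partial1of2E; have [_ ->] := dF v s v1 s1.
have MN0 : forall s : measurableTypeR R, 0 <= (fun=> M * N) s by move=> _; rewrite mulr_ge0.
have iMN : mu.-integrable `[- r, 0] (EFin \o (fun=> M * N)).
  by apply: within_cont_integrable => x; exact: cvg_cst.
have bF (v s : R) : `]t - 1, t + 1[%classic v -> `[- r, 0]%classic s ->
    `|partial1of2 F v s| <= M * N.
  rewrite /= !in_itv /= => /andP[v1 v2] /andP[s1 s2].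
  by rewrite dFE // normrM ler_pM // ?kM ?s1 // gN // winI.
apply: is_derive_dwithin; split.
  exact: (derivable_under_integral mB tI iF dF1 MN0 iMN bF).
rewrite -derive1E (differentiation_under_integral mB tI iF dF1 MN0 iMN bF).
apply: eq_Rintegral => s; rewrite inE /= in_itv /= => /andP[s1 s2].
by rewrite dFE // ltrBlDr ltrDl.
Qed.

End SlidingWindow.

(** * Increments of absolutely continuous functions *)

Section Increments.
Context {R : realType}.
Let mu : {measure set (measurableTypeR R) -> \bar R} := @lebesgue_measure R.

(** Listed from right to left, so that a chain grows at its right end by [cons]. *)
Fixpoint chain (a : R) (s : seq (R * R)) (t : R) : Prop :=
  if s is p :: s' then [/\ p.1 <= p.2, p.2 <= t & chain a s' p.1] else a <= t.

Lemma chain_weaken a s t t' : t <= t' -> chain a s t -> chain a s t'.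
Proof.
case: s => [|p s] /= tt' => [h|[? h ?]]; first exact: le_trans tt'.
by split=> //; exact: le_trans tt'.
Qed.

Lemma chain_ge a s t : chain a s t -> a <= t.
Proof.
elim: s t => [//|p s IH] t /= [h1 h2 /IH h3].
exact: le_trans h3 (le_trans h1 h2).
Qed.

Lemma chain_nth a s t i : chain a s t -> (i < size s)%N ->
  let p := nth (0, 0) s i in [/\ a <= p.1, p.1 <= p.2 & p.2 <= t].
Proof.
elim: s t i => [//|p s IH] t [|i] /= [h1 h2 h3]; first by split=> //; exact: chain_ge h3.
move=> /(IH _ _ h3)[h4 h5 h6]; split=> //.
exact: le_trans h6 (le_trans h1 h2).
Qed.

Lemma chain_lt a s t i j : chain a s t -> (i < j < size s)%N ->
  (nth (0, 0) s j).2 <= (nth (0, 0) s i).1.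
Proof.
elim: s t i j => [|p s IH] t i j /=; first by rewrite andbF.
case: i j => [|i] [|j] //= [h1 h2 h3]; last exact: (IH _ _ _ h3).
by rewrite ltnS => /(chain_nth h3)[].
Qed.

Definition covered (O : set R) (s : seq (R * R)) :=
  forall p, p \in s -> forall x, p.1 <= x <= p.2 -> O x.

Lemma chain_length a s t (O : set R) : open O -> chain a s t -> covered O s ->
  ((\sum_(p <- s) (p.2 - p.1))%:E <= mu (O `&` `[a, t[))%E.
Proof.
move=> oO; have mO : measurable O by exact: measurable_realfun.open_measurable.
have mI (u v : R) : measurable (`[u, v[%classic : set (measurableTypeR R)).
  exact: measurable_itv.
elim: s t => [|p s IH] t /=; first by rewrite big_nil measure_ge0.
case=> h1 h2 h3 cO; rewrite big_cons EFinD addeC.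
have /(IH _ h3) {}IH : covered O s by move=> q qs; apply: cO; rewrite inE qs orbT.
have pE : (p.2 - p.1)%:E = lebesgue_measure `[p.1, p.2[%classic.
  rewrite lebesgue_measure_itv /= lte_fin.
  by case: (ltgtP p.1 p.2) h1 => // -> _; rewrite subrr.
have {}pE : _ = mu `[p.1, p.2[%classic := pE.
apply: (@le_trans _ _ (mu ((O `&` `[a, p.1[) `|` `[p.1, p.2[))).
  rewrite measureU ?pE; first exact: leeD.
  - by apply: measurableI.
  - exact: mI.
  - apply/seteqP; split=> // x /= [[_]]; rewrite !in_itv /= => /andP[_ xp] /andP[px _].
    by have := lt_le_trans xp px; rewrite ltxx.
apply: le_measure; rewrite ?inE.
- by apply: measurableU; [exact: measurableI|exact: mI].
- exact: measurableI.
- have ap := chain_ge h3.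
  move=> x [[Ox]|] /=; rewrite !in_itv /= => /andP[x1 x2]; split=> //.
  + by rewrite x1 (lt_le_trans x2) // (le_trans h1).
  + by apply: (cO p); rewrite ?mem_head // x1 ltW.
  + by rewrite (le_trans ap x1) (lt_le_trans x2).
Qed.

(** Outside [O] the growth rate of [g] is at most [c], by the straddle estimate
    at the points of differentiability; the increments of [g] over a chain of
    intervals inside [O] account for the rest.  Compactness enters as a
    supremum: the set of endpoints [t] for which the claim holds on [[a, t]]
    contains its supremum, and cannot stop before [b]. *)
Lemma increment_cover (g : R -> R) (a b c e : R) (O : set R) :
  a <= b -> 0 < e -> open O ->
  (forall t, a <= t <= b -> O t \/ exists2 l, l <= c & dwithin `[a, b] g t l) ->
  exists s, [/\ chain a s b, covered O s &
    g b - g a <= (c + e) * (b - a) +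
      \sum_(p <- s) (g p.2 - g p.1 - (c + e) * (p.2 - p.1))].
Proof.
move=> ab e0 oO H.
pose P t := exists s, [/\ chain a s t, covered O s &
    g t - g a <= (c + e) * (t - a) +
      \sum_(p <- s) (g p.2 - g p.1 - (c + e) * (p.2 - p.1))].
pose E := [set t | a <= t <= b /\ P t].
have Ea : E a.
  split; first by rewrite lexx.
  by exists [::]; split=> //=; rewrite big_nil !subrr mulr0 addr0.
have supE : has_sup E by split; [exists a|exists b => t [/andP[]]].
pose S := sup E.
have aS : a <= S by apply: ub_le_sup => //; case: supE.
have Sb : S <= b by apply: ge_sup; [exists a|move=> t [/andP[]]].
have [d d0 step] : exists2 d : R, 0 < d & forall u v, a <= u -> S - d < u ->
    u <= S -> S <= v -> v < S + d -> v <= b -> P u -> P v.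
  have [OS|[l lc dl]] : O S \/ exists2 l, l <= c & dwithin `[a, b] g S l.
  - by apply: H; rewrite aS.
  - have [d /= d0 dO] : nbhs S O by exact: open_nbhs_nbhs.
    exists d => // u v au Su uS Sv vS vb [s [cs Os gs]].
    exists ((u, v) :: s); split=> /=.
    + by split=> //; exact: le_trans Sv.
    + move=> p; rewrite inE => /predU1P[->{p} x /= /andP[x1 x2]|/Os//].
      by apply: dO; rewrite /ball /= ltr_norml; apply/andP; split; lra.
    + rewrite big_cons /=; move: gs; set sm := \sum_(_ <- _) _; move: sm => sm; lra.
  - have /is_derive_withinP/(_ e e0)[d d0 hd] := dl.
    exists d => // u v au Su uS Sv vS vb [s [cs Os gs]].
    exists s; split=> //; first by apply: chain_weaken cs; exact: le_trans Sv.
    have h1 : `|g u - g S - (u - S) * l| <= e * `|u - S|.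
      apply: hd; first by rewrite /= in_itv /= au (le_trans uS).
      by rewrite ltr_norml; apply/andP; split; lra.
    have h2 : `|g v - g S - (v - S) * l| <= e * `|v - S|.
      apply: hd; first by rewrite /= in_itv /= vb andbT (le_trans aS).
      by rewrite ltr_norml; apply/andP; split; lra.
    move: h1 h2; rewrite (ler0_norm (x := u - S)) ?subr_le0 //.
    rewrite (ger0_norm (x := v - S)) ?subr_ge0 // !ler_norml.
    move=> /andP[h1 _] /andP[_ h2].
    have h3 : (v - u) * l <= (v - u) * c.
      by apply: ler_wpM2l => //; rewrite subr_ge0; exact: le_trans Sv.
    move: gs; set sm := \sum_(_ <- _) _; move: sm => sm gs; lra.
have [u [/andP[au ub] Pu] Su] : exists2 u, E u & S - d < u by exact: sup_adherent.
have uS : u <= S by apply: ub_le_sup; [case: supE|split=> //; rewrite au].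
have [Sb'|bS] := ltP S b; last first.
  have SE : S = b by apply/eqP; rewrite eq_le Sb.
  by apply: (step u b) => //; rewrite SE // ltrDl.
pose v := Num.min b (S + d / 2).
have Sv : S < v by rewrite /v lt_min Sb' ltrDl divr_gt0.
have vb : v <= b by rewrite ge_min lexx.
have vd : v < S + d by apply: (@le_lt_trans _ _ (S + d / 2)); [rewrite ge_min lexx orbT|lra].
have : v <= S.
  apply: ub_le_sup; first by case: supE.
  split; first by rewrite vb andbT; exact/ltW/(le_lt_trans aS).
  exact: (step u v au Su uS (ltW Sv) vd vb).
by rewrite leNgt Sv.
Qed.

(** The exceptional null set is put inside an open set of small measure; there
    absolute continuity makes the increments of [g] small. *)
Lemma ac_increment (g : R -> R) (a b c : R) (N : set R) :
  a <= b -> abs_continuous_on (V := R^o) a b g ->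
  measurable N -> mu N = 0%E ->
  (forall t, a <= t <= b -> ~ N t -> exists2 l, l <= c & dwithin `[a, b] g t l) ->
  g b - g a <= c * (b - a).
Proof.
move=> ab acg mN N0 dg; apply/ler_addgt0Pr => e' e'0.
pose e := e' / (b - a + 2); have e0 : 0 < e by rewrite divr_gt0 //; lra.
have [d d0 hd] := acg e e0.
pose k := `|c| + e + 1; have k0 : 0 < k by rewrite /k; have := normr_ge0 c; lra.
pose d1 := Num.min d (e / k).
have d10 : 0 < d1 by rewrite lt_min d0 divr_gt0.
have [|O [oO NO Om]] := @lebesgue_regularity_outer R N d1 mN _ d10.
  by rewrite [X in (X < _)%E](_ : _ = 0%E) ?ltry.
have mO : measurable O by exact: measurable_realfun.open_measurable.
have muO : (mu O < d1%:E)%E.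
  rewrite -(setDUK NO).
  apply: le_lt_trans (measureU2 mu mN (measurableD mO mN)) _.
  by rewrite [X in (X + _)%E](_ : _ = 0%E) ?add0e.
have [|s [cs Os gs]] := @increment_cover g a b c e O ab e0 oO.
  move=> t tab; have [Nt|nNt] := pselect (N t); first by left; exact: NO.
  by right; exact: dg.
pose len := \sum_(p <- s) (p.2 - p.1).
have lend : len < d1.
  rewrite -lte_fin; apply: le_lt_trans muO.
  apply: le_trans (chain_length oO cs Os) _; apply: le_measure; rewrite ?inE //.
  by apply: measurableI => //; exact: measurable_itv.
have [lend' lene] : len < d /\ len < e / k by apply/andP; rewrite -lt_min.
have sumE (F : R * R -> R) :
    \sum_(p <- s) F p = \sum_(i < size s) F (nth (0, 0) s i).
  by rewrite (big_nth (0, 0)) big_mkord.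
have := hd (size s) (fun i => (nth (0, 0) s i).1) (fun i => (nth (0, 0) s i).2).
rewrite -(sumE (fun p => p.2 - p.1)) -(sumE (fun p => `|g p.2 - g p.1|)) -/len.
have cin (i : 'I_(size s)) (p := nth (0, 0) s i) :
    a <= p.1 /\ p.1 <= p.2 /\ p.2 <= b.
  by have [h1 h2 h3] := chain_nth cs (ltn_ord i).
have cdisj : trivIset [set: 'I_(size s)]
    (fun i => `](nth (0, 0) s i).1, (nth (0, 0) s i).2[%classic).
  move=> i j _ _ [x [/=]]; rewrite !in_itv /= => /andP[i1 i2] /andP[j1 j2].
  apply/val_inj; case: (ltngtP i j) => // ij.
    have := @chain_lt _ _ _ i j cs; rewrite ij ltn_ord => /(_ isT) h.
    by have := lt_trans i1 (lt_le_trans j2 h); rewrite ltxx.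
  have := @chain_lt _ _ _ j i cs; rewrite ij ltn_ord => /(_ isT) h.
  by have := lt_trans j1 (lt_le_trans i2 h); rewrite ltxx.
move=> /(_ cin cdisj lend') sg.
have len0 : 0 <= len.
  rewrite /len sumE; apply: sumr_ge0 => i _.
  by rewrite subr_ge0; have [] := chain_nth cs (ltn_ord i).
have : \sum_(p <- s) (g p.2 - g p.1 - (c + e) * (p.2 - p.1)) <= e + k * len.
  rewrite sumrB -mulr_sumr -/len.
  have : \sum_(p <- s) (g p.2 - g p.1) <= \sum_(p <- s) `|g p.2 - g p.1|.
    by apply: ler_sum => p _; exact: ler_norm.
  have : - (c + e) * len <= k * len.
    by apply: ler_wpM2r => //; rewrite /k; have := ler_norm (- c); rewrite normrN; lra.
  lra.
have : k * len <= e by rewrite mulrC -ler_pdivlMr // ltW.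
have : e * (b - a + 2) = e' by rewrite /e divfK //; lra.
lra.
Qed.

(** The covering lemma with an empty open set: no interval can be covered. *)
Lemma derivative_le_increment (g : R -> R) (a b c : R) : a <= b ->
  (forall t, a <= t <= b -> exists2 l, l <= c & dwithin `[a, b] g t l) ->
  g b - g a <= c * (b - a).
Proof.
move=> ab dg; apply/ler_addgt0Pr => e' e'0.
pose e := e' / (b - a + 1); have e0 : 0 < e by rewrite divr_gt0 //; lra.
have [|s [cs Os]] := @increment_cover g a b c e set0 ab e0 open0.
  by move=> t tab; right; exact: dg.
case: s cs Os => [_ _|p s [p12 _ _] /(_ p (mem_head _ _) p.1)]; last first.
  by rewrite lexx p12 => /(_ isT).
rewrite big_nil addr0.
have : e * (b - a + 1) = e' by rewrite /e divfK //; lra.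
lra.
Qed.

Lemma ac_subinterval (V : normedModType R) (g : R -> V) (a b a' b' : R) :
  a <= a' -> b' <= b -> abs_continuous_on a b g -> abs_continuous_on a' b' g.
Proof.
move=> aa bb acg e /acg[d d0 hd]; exists d => // k u v uv; apply: hd => i.
have [h1 [h2 h3]] := uv i; split; first exact: le_trans h1.
by split=> //; exact: le_trans h3 bb.
Qed.

Lemma ac_coord n (x : R -> 'cV[R]_n) (a b : R) i :
  abs_continuous_on a b x -> abs_continuous_on (V := R^o) a b (fun t => x t i 0).
Proof.
move=> acx e /acx[d d0 hd]; exists d => // k u v uv tr lt.
apply: le_lt_trans (hd k u v uv tr lt); apply: ler_sum => j _.
by have := norm_coord (x (v j) - x (u j)) i 0; rewrite !mxE.
Qed.

Lemma ac_opp (g : R -> R) (a b : R) : abs_continuous_on (V := R^o) a b g ->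
  abs_continuous_on (V := R^o) a b (fun t => - g t).
Proof.
move=> acg e /acg[d d0 hd]; exists d => // k u v uv tr lt.
apply: le_lt_trans (hd k u v uv tr lt); apply: ler_sum => j _.
by rewrite -opprD normrN.
Qed.

(** An absolutely continuous function whose derivative agrees almost everywhere
    with a continuous [G] is differentiable everywhere: near [t] the derivative
    stays within [e] of [G t], and so do the slopes of the chords. *)
Lemma ac_derive_everywhere (x G : R -> R) (t0 : R)
  (D : set R := `[t0, +oo[%classic) :
  (forall T, t0 <= T -> abs_continuous_on (V := R^o) t0 T x) ->
  {ae lebesgue_measure, forall t, t0 <= t -> dwithin D x t (G t)} ->
  {within D, continuous G} ->
  forall t, t0 <= t -> dwithin D x t (G t).
Proof.
move=> acx [N [mN N0 NP]] cG t tt; apply/is_derive_withinP => e e0.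
have DE s : t0 <= s -> D s by move=> ?; rewrite /D /= in_itv /= andbT.
have /within_contP/(_ t e (DE t tt) e0)[d d0 hd] := cG.
have chord (u v : R) : t0 <= u -> u <= v -> `|u - t| < d -> `|v - t| < d ->
    `|x v - x u - (v - u) * G t| <= e * (v - u).
  move=> u0 uv ut vt.
  have acuv : abs_continuous_on (V := R^o) u v x.
    by apply: ac_subinterval (acx v _) => //; exact: le_trans uv.
  have near (s : R) : u <= s <= v -> ~ N s ->
      [/\ dwithin `[u, v] x s (G s), G s <= G t + e & - G s <= e - G t].
    move=> /andP[us sv] nNs.
    have s0 : t0 <= s by exact: le_trans us.
    have st : `|s - t| < d.
      move: ut vt; rewrite !ltr_norml => /andP[h1 _] /andP[_ h2].
      by clear - us sv h1 h2; apply/andP; split; lra.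
    have := hd s (DE s s0) st; rewrite ler_norml => /andP[h1 h2].
    split; [|clear - h2; lra|clear - h1; lra].
    apply: (@dwithin_subset _ D) => [z /=|].
      by rewrite in_itv /= => /andP[uz _]; apply: DE; exact: le_trans uz.
    by apply: contrapT => h; apply: nNs; apply: NP => /= /(_ s0).
  have up : x v - x u <= (G t + e) * (v - u).
    apply: (ac_increment uv acuv mN N0) => s us nNs.
    by have [h1 h2 _] := near s us nNs; exists (G s).
  have dn : - x v - - x u <= (e - G t) * (v - u).
    apply: (ac_increment (g := fun s => - x s) uv (ac_opp acuv) mN N0) => s us nNs.
    have [h1 _ h3] := near s us nNs; exists (- G s) => //.
    rewrite -mulN1r (_ : (fun _ => _) = fun s => -1 * x s); first exact: dwithinZ.
    by apply/funext => z; rewrite mulN1r.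
  by clear - up dn; rewrite ler_norml; apply/andP; split; lra.
exists d => // s; rewrite /D /= in_itv /= andbT => Ds st; have [ts|st'] := leP t s.
  rewrite (ger0_norm (x := s - t)) ?subr_ge0 //.
  by apply: chord => //; rewrite subrr normr0.
rewrite (ltr0_norm (x := s - t)) ?subr_lt0 // opprB -normrN.
have -> : - (x s - x t - (s - t) *: (G t : R^o)) = x t - x s - (t - s) * G t.
  by rewrite /GRing.scale /=; ring.
by apply: chord => //; [exact: ltW|rewrite subrr normr0].
Qed.

End Increments.

(** * Bounded bilinear forms on histories *)

Section BoundedBilinear.
Context {R : realType}.
Variables (r : R) (n : nat).
Hypothesis r_ge0 : 0 <= r.
Local Notation fn := (R -> 'cV[R]_n).
Local Notation D := (`[- r, 0]%classic : set R).
Local Notation mu := (@lebesgue_measure R).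
Implicit Types (phi psi h k : fn).

Lemma supnorm_ub phi th : mxcont (- r) 0 phi -> - r <= th <= 0 ->
  `|phi th| <= supnorm r phi.
Proof.
move=> cphi thr; apply: ub_le_sup; last by exists th => //=; rewrite in_itv.
have /boolp.choice[M hM] : forall i, exists M : R, 0 <= M /\
    forall s, - r <= s <= 0 -> `|phi s i 0| <= M.
  by move=> i; have [M M0 HM] := within_cont_bounded (cphi i 0); exists M.
exists (\sum_i M i) => _ [s /=] + <-; rewrite in_itv /= => sr.
apply: norm_le_coord => [|i j]; first by apply: sumr_ge0 => i _; case: (hM i).
rewrite ord1 (bigD1 i) //=; have [_ /(_ s sr)] := hM i => /le_trans; apply.
by rewrite lerDl; apply: sumr_ge0 => l _; case: (hM l).
Qed.

Lemma supnorm_ge0 phi : mxcont (- r) 0 phi -> 0 <= supnorm r phi.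
Proof.
move=> cphi; apply: le_trans (supnorm_ub (th := 0) cphi _) => //.
by rewrite lexx andbT oppr_le0.
Qed.

(** The functions range over [mxcont] rather than [history], because entrywise
    continuity propagates directly through linear combinations. *)
Definition bounded_bilinear (b : fn -> fn -> R) : Prop :=
  [/\ forall (a : R) h k psi, mxcont (- r) 0 h -> mxcont (- r) 0 k ->
        mxcont (- r) 0 psi ->
        b (fun th => a *: h th + k th) psi = a * b h psi + b k psi,
      forall (a : R) h k phi, mxcont (- r) 0 h -> mxcont (- r) 0 k ->
        mxcont (- r) 0 phi ->
        b phi (fun th => a *: h th + k th) = a * b phi h + b phi k
    & exists2 c : R, 0 <= c & forall phi psi, mxcont (- r) 0 phi -> mxcont (- r) 0 psi ->
        `|b phi psi| <= c * (supnorm r phi * supnorm r psi)].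

Definition bounded_linear (l : fn -> R) : Prop :=
  (forall (a : R) h k, mxcont (- r) 0 h -> mxcont (- r) 0 k ->
     l (fun th => a *: h th + k th) = a * l h + l k) /\
  exists2 c : R, 0 <= c & forall phi, mxcont (- r) 0 phi ->
     `|l phi| <= c * supnorm r phi.

Lemma bounded_bilinearD b b' : bounded_bilinear b -> bounded_bilinear b' ->
  bounded_bilinear (fun phi psi => b phi psi + b' phi psi).
Proof.
move=> [bl br [c c0 hc]] [bl' br' [c' c0' hc']]; split.
- by move=> a h k psi ch ck cp; rewrite bl // bl' //; ring.
- by move=> a h k psi ch ck cp; rewrite br // br' //; ring.
- exists (c + c'); first exact: addr_ge0.
  move=> phi psi cp cs; apply: le_trans (ler_normD _ _) _.
  by rewrite mulrDl; apply: lerD; [exact: hc|exact: hc'].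
Qed.

Lemma bounded_bilinearZ (a : R) b : bounded_bilinear b ->
  bounded_bilinear (fun phi psi => a * b phi psi).
Proof.
move=> [bl br [c c0 hc]]; split.
- by move=> a' h k psi ch ck cp; rewrite bl //; ring.
- by move=> a' h k psi ch ck cp; rewrite br //; ring.
- exists (`|a| * c); first by rewrite mulr_ge0.
  by move=> phi psi cp cs; rewrite normrM -mulrA ler_wpM2l //; exact: hc.
Qed.

Lemma bounded_bilinear0 : bounded_bilinear (fun _ _ => 0).
Proof.
split; try by move=> *; rewrite mulr0 addr0.
by exists 0 => // phi psi _ _; rewrite normr0 mul0r.
Qed.

Lemma bounded_bilinear_sum (I : Type) (s : seq I) (b : I -> fn -> fn -> R) :
  (forall i, bounded_bilinear (b i)) ->
  bounded_bilinear (fun phi psi => \sum_(i <- s) b i phi psi).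
Proof.
move=> hb; elim: s => [|i s IH].
  rewrite (_ : (fun _ _ => _) = fun _ _ => 0); first exact: bounded_bilinear0.
  by apply/funext => phi; apply/funext => psi; rewrite big_nil.
rewrite (_ : (fun _ _ => _) =
    fun phi psi => b i phi psi + \sum_(j <- s) b j phi psi).
  exact: bounded_bilinearD.
by apply/funext => phi; apply/funext => psi; rewrite big_cons.
Qed.

Lemma bounded_bilinear_prod (l l' : fn -> R) : bounded_linear l -> bounded_linear l' ->
  bounded_bilinear (fun phi psi => l phi * l' psi).
Proof.
move=> [ll [c c0 hc]] [ll' [c' c0' hc']]; split.
- by move=> a h k psi ch ck _; rewrite ll //; ring.
- by move=> a h k psi ch ck _; rewrite ll' //; ring.
- exists (c * c'); first exact: mulr_ge0.
  by move=> phi psi cp cs; rewrite normrM mulrACA ler_pM //; [exact: hc|exact: hc'].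
Qed.

Lemma coord_bound (A : 'M[R]_n) i : exists2 c : R, 0 <= c & forall phi th,
  mxcont (- r) 0 phi -> - r <= th <= 0 -> `|(A *m phi th) i 0| <= c * supnorm r phi.
Proof.
exists (\sum_j `|A i j|); first by apply: sumr_ge0.
move=> phi th cphi thr; rewrite mxE mulr_suml; apply: le_trans (ler_norm_sum _ _ _) _.
apply: ler_sum => j _; rewrite normrM ler_wpM2l //.
exact: le_trans (norm_coord _ _ _) (supnorm_ub cphi thr).
Qed.

Lemma coord_linear (A : 'M[R]_n) i a (u v : 'cV[R]_n) :
  (A *m (a *: u + v)) i 0 = a * (A *m u) i 0 + (A *m v) i 0.
Proof. by rewrite mulmxDr -scalemxAr !mxE. Qed.

Lemma bounded_linear_eval (A : 'M[R]_n) i (th : R) : - r <= th <= 0 ->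
  bounded_linear (fun phi => (A *m phi th) i 0).
Proof.
move=> thr; split=> [a h k _ _|]; first exact: coord_linear.
by have [c c0 hc] := coord_bound A i; exists c => // phi cphi; exact: hc.
Qed.

Lemma mxcont_mulc (A : 'M[R]_n) phi : mxcont (- r) 0 phi ->
  mxcont (- r) 0 (fun th => A *m phi th).
Proof. by move=> cphi; apply: mxcontM => //; exact: mxcont_cst. Qed.

Lemma bounded_linear_int (A : 'M[R]_n) i (k : R -> R) :
  {within D, continuous k} ->
  bounded_linear (fun phi => \int[mu]_(th in D) (k th * (A *m phi th) i 0)).
Proof.
move=> ck; have ci phi : mxcont (- r) 0 phi ->
    {within D, continuous (fun th => k th * (A *m phi th) i 0)}.
  by move=> cphi; apply: within_contM => //; exact: mxcont_mulc.
split=> [a h l ch cl|].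
  rewrite -RintegralZl; [|exact: measurable_itv|exact/within_cont_integrable/ci].
  rewrite -RintegralD; first last.
  - exact/within_cont_integrable/ci.
  - by apply/within_cont_integrable/within_contM; [exact: within_cont_cst|exact: ci].
  - exact: measurable_itv.
  by apply: eq_Rintegral => th _; rewrite coord_linear; ring.
have [M M0 kM] := within_cont_bounded ck; have [c c0 hc] := coord_bound A i.
exists (M * c * r); first by rewrite !mulr_ge0.
move=> phi cphi; have := @Rint_bound _ (- r) 0 _ (M * (c * supnorm r phi)) _ (ci _ cphi).
rewrite oppr_le0 => /(_ r_ge0); rewrite sub0r opprK.
have -> : M * (c * supnorm r phi) * r = M * c * r * supnorm r phi by ring.
apply=> th /=; rewrite in_itv /= => thr.
by rewrite normrM ler_pM // ?kM // hc.
Qed.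

Lemma bounded_bilinear_int (A : 'M[R]_n) i j (k : R -> R) :
  {within D, continuous k} ->
  bounded_bilinear (fun phi psi =>
    \int[mu]_(th in D) (k th * ((A *m phi th) i 0 * (A *m psi th) j 0))).
Proof.
move=> ck; have ci phi psi : mxcont (- r) 0 phi -> mxcont (- r) 0 psi ->
    {within D, continuous (fun th => k th * ((A *m phi th) i 0 * (A *m psi th) j 0))}.
  by move=> cphi cpsi; do 2 (apply: within_contM => //); exact: mxcont_mulc.
split=> [a h l psi ch cl cp|a h l psi ch cl cp|].
- rewrite -RintegralZl; [|exact: measurable_itv|exact/within_cont_integrable/ci].
  rewrite -RintegralD; first last.
  + exact/within_cont_integrable/ci.
  + by apply/within_cont_integrable/within_contM; [exact: within_cont_cst|exact: ci].
  + exact: measurable_itv.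
  by apply: eq_Rintegral => th _; rewrite coord_linear; ring.
- rewrite -RintegralZl; [|exact: measurable_itv|exact/within_cont_integrable/ci].
  rewrite -RintegralD; first last.
  + exact/within_cont_integrable/ci.
  + by apply/within_cont_integrable/within_contM; [exact: within_cont_cst|exact: ci].
  + exact: measurable_itv.
  by apply: eq_Rintegral => th _; rewrite coord_linear; ring.
have [M M0 kM] := within_cont_bounded ck.
have [c c0 hc] := coord_bound A i; have [c' c0' hc'] := coord_bound A j.
exists (M * (c * c') * r); first by rewrite !mulr_ge0.
move=> phi psi cphi cpsi.
have := @Rint_bound _ (- r) 0 _ (M * (c * supnorm r phi * (c' * supnorm r psi))) _
  (ci _ _ cphi cpsi).
rewrite oppr_le0 => /(_ r_ge0); rewrite sub0r opprK.
have -> : M * (c * supnorm r phi * (c' * supnorm r psi)) * r =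
  M * (c * c') * r * (supnorm r phi * supnorm r psi) by ring.
apply=> th /=; rewrite in_itv /= => thr.
by rewrite normrM ler_pM // ?kM // normrM ler_pM // ?hc ?hc'.
Qed.

(** The derivative of the quadratic functional of a bounded bilinear [b] at
    [phi] is [h |-> b phi h + b h phi], with remainder [b h h]. *)
Lemma differentiable_quadratic b : bounded_bilinear b ->
  differentiable_functional r (fun phi => b phi phi).
Proof.
move=> [bl br [c c0 hc]] phi /mxcont_within cphi.
have hist h : history r h -> mxcont (- r) 0 h by exact: mxcont_within.
exists (fun h => b phi h + b h phi); split.
- by move=> a h k /hist ch /hist ck; rewrite bl // br //; ring.
- exists (2 * c * supnorm r phi) => h /hist ch; apply: le_trans (ler_normD _ _) _.
  have := hc phi h cphi ch; have := hc h phi ch cphi; lra.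
- move=> e e0; exists (e / (c + 1)); first by rewrite divr_gt0 //; lra.
  move=> h /hist ch hd.
  have addE (p q : fn) : (fun th => p th + q th) = (fun th => 1 *: p th + q th).
    by apply/funext => th; rewrite scale1r.
  have -> : b (fun th => phi th + h th) (fun th => phi th + h th) - b phi phi -
      (b phi h + b h phi) = b h h.
    rewrite addE bl //; last first.
      apply: mxcontD => //.
      by apply: mxcontZ => //; exact: within_cont_cst.
    by rewrite !br //; ring.
  apply: le_trans (hc h h ch ch) _; rewrite mulrA ler_wpM2r ?supnorm_ge0 //.
  have s0 := supnorm_ge0 ch.
  move: hd; rewrite ler_pdivlMr; last lra.
  by move=> hd; nra.
Qed.

End BoundedBilinear.

(** * The Krasovskii functional *)

Section Functional.
Context {R : realType}.
Variables (n d : nat) (r : R) (f : R -> 'cV[R]_d).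
Variables (Y P : 'M[R]_n) (Q : 'M[R]_(n, d * n)) (Rm : 'M[R]_(d * n)) (S U : 'M[R]_n).
Hypothesis r_gt0 : 0 < r.
Hypothesis f_cont : mxcont (- r) 0 f.
Local Notation fn := (R -> 'cV[R]_n).
Local Notation D := (`[- r, 0]%classic : set R).
Local Notation mu := (@lebesgue_measure R).
Implicit Types (phi psi : fn) (k : R -> R).

(** [Y] is the change of variables [y = Y x], with [Y = X^-1] in the application,
    in which the matrices of the inequalities are those of the functional. *)
Definition fmoment phi : 'M[R]_(n, d) :=
  mxint D (fun th => (Y *m phi th) *m (f th)^T).

Definition lkstate phi : 'cV[R]_(n + d * n) :=
  col_mx (Y *m phi 0) (cvec (fmoment phi)).

Definition qmoment k phi psi : 'M[R]_n :=
  mxint D (fun th => k th *: ((Y *m phi th) *m (Y *m psi th)^T)).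

(** The polarised form of the Krasovskii functional
    [Z^T [P, Q; Q^T, R] Z + int y^T (S + (th + r) U) y]. *)
Definition lkform phi psi : R :=
  bform (block_mx P Q Q^T Rm) (lkstate phi) (lkstate psi)
  + \tr (S *m qmoment (fun=> 1) phi psi)
  + \tr (U *m qmoment (fun th => th + r) phi psi).

Definition lkfun phi : R := lkform phi phi.

Lemma lkfun_histories : functional_on_histories r lkfun.
Proof.
move=> phi psi E.
have E0 : phi 0 = psi 0 by apply: E; rewrite lexx oppr_le0 ltW.
have E1 : fmoment phi = fmoment psi by apply: eq_mxint => th /E ->.
have E2 k : qmoment k phi phi = qmoment k psi psi by apply: eq_mxint => th /E ->.
by rewrite /lkfun /lkform /lkstate E0 E1 !E2.
Qed.

Lemma weight_cont : {within D, continuous (fun th : R => th + r)}.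
Proof.
by apply: continuous_subspaceT => x; apply: cvgD; [exact: cvg_id|exact: cvg_cst].
Qed.

Lemma outer_scale_cont k phi psi : {within D, continuous k} ->
  mxcont (- r) 0 phi -> mxcont (- r) 0 psi ->
  mxcont (- r) 0 (fun th => k th *: ((Y *m phi th) *m (Y *m psi th)^T)).
Proof.
move=> ck cp cs; apply: mxcontZ => //; apply: mxcontM; first exact: mxcont_mulc.
by apply: mxcont_tr; exact: mxcont_mulc.
Qed.

Lemma lkstate_linear i : bounded_linear r (fun phi => lkstate phi i 0).
Proof.
case: (split_ordP i) => j ->.
  rewrite (_ : (fun _ => _) = (fun phi => (Y *m phi 0) j 0)); last first.
    by apply/funext => phi; rewrite /lkstate col_mxEu.
  by apply: bounded_linear_eval; rewrite lexx oppr_le0 ltW.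
rewrite (_ : (fun _ => _) = (fun phi => \int[mu]_(th in D)
    (f th (mxtens_unindex j).1 0 * (Y *m phi th) (mxtens_unindex j).2 0))).
  by apply: bounded_linear_int; [exact: ltW|exact: f_cont].
apply/funext => phi; rewrite /lkstate col_mxEd !mxE; apply: eq_Rintegral => th _.
by rewrite mxE big_ord1 [(f th)^T _ _]mxE mulrC.
Qed.

Lemma qmoment_bilinear (A : 'M[R]_n) k : {within D, continuous k} ->
  bounded_bilinear r (fun phi psi => \tr (A *m qmoment k phi psi)).
Proof.
move=> ck; rewrite (_ : (fun _ _ => _) = (fun phi psi => \sum_i \sum_j A i j *
   \int[mu]_(th in D) (k th * ((Y *m phi th) j 0 * (Y *m psi th) i 0)))).
  do 2 (apply: bounded_bilinear_sum => ?); apply: bounded_bilinearZ.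
  by apply: bounded_bilinear_int => //; exact: ltW.
apply/funext => phi; apply/funext => psi; apply: eq_bigr => i _.
rewrite mxE; apply: eq_bigr => j _; rewrite mxE; congr (_ * _).
by apply: eq_Rintegral => th _; rewrite mxE [in LHS]mxE big_ord1 [(Y *m psi th)^T _ _]mxE.
Qed.

Lemma lkform_bilinear : bounded_bilinear r lkform.
Proof.
apply: bounded_bilinearD; first apply: bounded_bilinearD.
- rewrite (_ : (fun _ _ => _) = (fun phi psi => \sum_i \sum_j block_mx P Q Q^T Rm i j
     * (lkstate phi i 0 * lkstate psi j 0))); last first.
    by apply/funext => phi; apply/funext => psi; exact: bformE.
  do 2 (apply: bounded_bilinear_sum => ?); apply: bounded_bilinearZ.
  by apply: bounded_bilinear_prod; exact: lkstate_linear.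
- by apply: qmoment_bilinear; exact: within_cont_cst.
- by apply: qmoment_bilinear; exact: weight_cont.
Qed.

Lemma tr_qmoment (A : 'M[R]_n) k phi : {within D, continuous k} ->
  mxcont (- r) 0 phi ->
  \tr (A *m qmoment k phi phi) =
  \int[mu]_(th in D) (k th * bform A (Y *m phi th) (Y *m phi th)).
Proof.
move=> ck cp; rewrite mxint_trace; last exact: outer_scale_cont.
apply: eq_Rintegral => th _.
by rewrite -scalemxAr mxtraceZ trace_outer.
Qed.

Lemma bform_cont (A : 'M[R]_n) phi : mxcont (- r) 0 phi ->
  {within D, continuous (fun th => bform A (Y *m phi th) (Y *m phi th))}.
Proof.
move=> cp; have cY := mxcont_mulc (A := Y) cp.
have : mxcont (- r) 0 (fun th => (Y *m phi th)^T *m A *m (Y *m phi th)).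
  apply: mxcontM => //; apply: mxcontM; last exact: mxcont_cst.
  exact: mxcont_tr.
by move=> /(_ 0 0).
Qed.

Lemma le_tr_qmoment (A B : 'M[R]_n) (k l : R -> R) (c : R) phi :
  {within D, continuous k} -> {within D, continuous l} -> mxcont (- r) 0 phi ->
  (forall (th : R) u, - r <= th <= 0 -> k th * bform A u u <= c * (l th * bform B u u)) ->
  \tr (A *m qmoment k phi phi) <= c * \tr (B *m qmoment l phi phi).
Proof.
move=> ck cl cp H; rewrite !tr_qmoment //.
have iB : {within D, continuous (fun th => l th * bform B (Y *m phi th) (Y *m phi th))}.
  by apply: within_contM => //; exact: bform_cont.
rewrite -RintegralZl; [|exact: measurable_itv|exact: within_cont_integrable].
apply: le_Rintegral; first exact: measurable_itv.
- by apply/within_cont_integrable/within_contM => //; exact: bform_cont.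
- by apply/within_cont_integrable/within_contM => //; exact: within_cont_cst.
- by move=> th; rewrite /= in_itv /=; exact: H.
Qed.

Lemma tr_qmoment_ge0 (A : 'M[R]_n) k phi : posdefmx A ->
  {within D, continuous k} -> mxcont (- r) 0 phi ->
  (forall th, - r <= th <= 0 -> 0 <= k th) -> 0 <= \tr (A *m qmoment k phi phi).
Proof.
move=> pA ck cp k0; rewrite tr_qmoment //; apply: Rintegral_ge0 => th /=.
by rewrite in_itv /= => /k0 kth; rewrite mulr_ge0 ?posdef_ge0.
Qed.

Lemma Bessel_qmoment (A : 'M[R]_n) phi : posdefmx (gram r f) ->
  posdefmx A -> mxcont (- r) 0 phi ->
  bform (sfF r f *t A) (cvec (fmoment phi)) (cvec (fmoment phi)) <=
  \tr (A *m qmoment (fun=> 1) phi phi).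
Proof.
move=> pG pA cp.
have -> : qmoment (fun=> 1) phi phi = mxint D (fun th => (Y *m phi th) *m (Y *m phi th)^T).
  by apply: eq_mxint => th _; rewrite scale1r.
apply: matrix_Bessel => //; first exact: mxcont_mulc.
by move=> u; exact: posdef_ge0.
Qed.

(** Bessel's inequality turns the [S] term into the missing block [F *t S]. *)
Lemma lkfun_lower : posdefmx (gram r f) -> posdefmx S -> posdefmx U ->
  posdefmx (block_mx P Q Q^T (Rm + sfF r f *t S)) ->
  exists2 e : R, 0 < e & forall phi, mxcont (- r) 0 phi ->
    e * sqn (Y *m phi 0) <= lkfun phi.
Proof.
move=> pG pS pU /posdef_coercive[e e0 he]; exists e => // phi cp.
have B := Bessel_qmoment pG pS cp.
have W : 0 <= \tr (U *m qmoment (fun th => th + r) phi phi).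
  apply: tr_qmoment_ge0 => //; first exact: weight_cont.
  by move=> th /andP[h _]; rewrite -lerBlDr sub0r.
have := he (lkstate phi); rewrite /lkstate sqn_col !bform_block bformDl.
rewrite /lkfun /lkform /lkstate bform_block mulrDr => H.
have : 0 <= e * sqn (cvec (fmoment phi)) by rewrite mulr_ge0 ?sqn_ge0 // ltW.
lra.
Qed.

(** With [int y^T U y] on the right, the functional is bounded by the terms
    that its derivative controls; this is what turns strict decrease into
    exponential decay. *)
Lemma lkfun_upper : posdefmx U -> exists2 c : R, 0 < c & forall phi, mxcont (- r) 0 phi ->
  lkfun phi <= c * (sqn (Y *m phi 0) + sqn (cvec (fmoment phi))
                    + \tr (U *m qmoment (fun=> 1) phi phi)).
Proof.
move=> pU; have [c1 c10 hc1] := bform_bound (block_mx P Q Q^T Rm).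
have [c2 c20 hc2] := posdef_dominates S pU.
exists (c1 + c2 + r); first by rewrite !addr_gt0.
move=> phi cp; rewrite /lkfun /lkform.
have h1 : bform (block_mx P Q Q^T Rm) (lkstate phi) (lkstate phi) <=
    c1 * (sqn (Y *m phi 0) + sqn (cvec (fmoment phi))).
  by rewrite -sqn_col; apply: le_trans (ler_norm _) (hc1 _).
have c1c : {within D, continuous (fun=> 1 : R)} by exact: within_cont_cst.
have h2 : \tr (S *m qmoment (fun=> 1) phi phi) <= c2 * \tr (U *m qmoment (fun=> 1) phi phi).
  by apply: le_tr_qmoment => // th u _; rewrite !mul1r.
have h3 : \tr (U *m qmoment (fun th => th + r) phi phi) <=
    r * \tr (U *m qmoment (fun=> 1) phi phi).
  apply: le_tr_qmoment => //; first exact: weight_cont.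
  move=> th u /andP[_ th0]; rewrite mul1r ler_wpM2r ?posdef_ge0 //.
  by rewrite gerDr.
have q0 : 0 <= \tr (U *m qmoment (fun=> 1) phi phi).
  by apply: tr_qmoment_ge0 => // th _.
have := sqn_ge0 (Y *m phi 0); have := sqn_ge0 (cvec (fmoment phi)).
move: (sqn (Y *m phi 0)) (sqn (cvec (fmoment phi))) q0 h1 h2 h3.
move: (\tr (U *m qmoment (fun=> 1) phi phi)) => q s s' q0 h1 h2 h3 s0 s0'.
have : 0 <= (c2 + r) * (s + s') by rewrite mulr_ge0 ?addr_ge0 // ltW // addr_gt0.
have : 0 <= c1 * q by rewrite mulr_ge0 // ltW.
lra.
Qed.

End Functional.

(** * The functional along a trajectory *)

Section SolutionSegments.
Context {R : realType}.
Local Notation mu := (@lebesgue_measure R).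

(** A trajectory is only continuous on a half line; clamping the argument extends
    it to the real line without changing the windows that matter. *)
Lemma continuous_clamp (g : R -> R) (c : R) :
  {within `[c, +oo[, continuous g} -> continuous (fun u => g (Num.max u c)).
Proof.
move=> /within_contP cg u; apply/cvgrPdist_le => e e0.
have cm z : `[c, +oo[%classic (Num.max z c : R).
  by rewrite /= in_itv /= andbT le_max lexx orbT.
have [d d0 hd] := cg (Num.max u c) e (cm u) e0.
exists d => //= s; rewrite /ball /= => us; rewrite distrC; apply: hd => //.
apply: le_lt_trans us; rewrite distrC.
have [uc|cu] := leP u c; have [sc|cs] := leP s c.
- by rewrite subrr normr0.
- by rewrite !ler0_norm; lra.
- by rewrite !ger0_norm; lra.
- by [].
Qed.

Lemma within_cont_shift (g : R -> R) (c a b t : R) :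
  {within `[c, +oo[, continuous g} -> c <= t + a ->
  {within `[a, b], continuous (fun s => g (t + s))}.
Proof.
move=> /within_contP cg ct; apply/within_contP => s e /=; rewrite in_itv /= => /andP[s1 s2] e0.
have inD z : a <= z -> `[c, +oo[%classic (t + z).
  by move=> az; rewrite /= in_itv /= andbT; lra.
have [d d0 hd] := cg (t + s) e (inD s s1) e0.
exists d => // z; rewrite /= in_itv /= => /andP[z1 z2] zs; apply: hd; first exact: inD.
by rewrite opprD addrACA subrr add0r.
Qed.

Lemma dwithin_LRcontinuous (k k' : R -> R) (a b : R) : a < b ->
  (forall s, a <= s <= b -> dwithin `[a, b] k s (k' s)) ->
  derivable_oo_LRcontinuous k a b /\ {in `]a, b[, derive1 k =1 k'}.
Proof.
move=> ab dk.
have ck s e : a <= s <= b -> 0 < e -> exists2 d : R, 0 < d &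
    forall z, a <= z <= b -> `|z - s| < d -> `|k z - k s| <= e.
  move=> sab e0; have /dwithin_cvg/cvgrPdist_le/(_ e e0)[d /= d0 hd] := dk s sab.
  exists d => // z zab zs; have [->|zNs] := eqVneq z s.
    by rewrite subrr normr0 ltW.
  by rewrite distrC; apply: hd => //; rewrite /ball /= distrC.
have dI s : s \in `]a, b[ -> is_derive s 1 k (k' s).
  rewrite in_itv /= => /andP[s1 s2].
  apply: (@dwithin_is_derive _ `[a, b]%classic); last by apply: dk; rewrite !ltW.
  exists (Num.min (s - a) (b - s)) => /=; first by rewrite lt_min !subr_gt0 s1.
  move=> z; rewrite /ball /= lt_min !ltr_norml => /andP[/andP[z1 z2] /andP[z3 z4]].
  by rewrite /= in_itv /=; apply/andP; split; lra.
split; last by move=> s /dI [_ <-]; rewrite derive1E.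
split; first by move=> s /dI[].
- apply/cvgrPdist_le => e e0.
  have [|d d0 hd] := ck a e _ e0; first by rewrite lexx ltW.
  exists (Num.min d (b - a)) => /=; first by rewrite lt_min d0 subr_gt0.
  move=> z; rewrite /ball /= lt_min => /andP[z1 z2] az; rewrite distrC; apply: hd.
    by rewrite (ltW az) /=; move: z2; rewrite distrC gtr0_norm ?subr_gt0 // ; lra.
  by rewrite distrC.
- apply/cvgrPdist_le => e e0.
  have [|d d0 hd] := ck b e _ e0; first by rewrite lexx ltW.
  exists (Num.min d (b - a)) => /=; first by rewrite lt_min d0 subr_gt0.
  move=> z; rewrite /ball /= lt_min => /andP[z1 z2] zb; rewrite distrC; apply: hd.
    by rewrite (ltW zb) andbT; move: z2; rewrite gtr0_norm ?subr_gt0 // ; lra.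
  by rewrite distrC.
Qed.

Lemma window_dwithin (r t0 t : R) (k k' g : R -> R) :
  0 < r -> t0 <= t -> {within `[- r, 0], continuous k'} ->
  (forall s, - r <= s <= 0 -> dwithin `[- r, 0] k s (k' s)) ->
  {within `[t0 - r, +oo[, continuous g} ->
  dwithin `[t0, +oo[ (fun t => \int[mu]_(s in `[- r, 0]) (k s * g (t + s))) t
    (k 0 * g t - k (- r) * g (t - r) - \int[mu]_(s in `[- r, 0]) (k' s * g (t + s))).
Proof.
move=> r0 tt ck' dk cg.
have [|dk1 dk2] := dwithin_LRcontinuous _ dk; first lra.
pose h u := g (Num.max u (t0 - r)).
have hE u : t0 - r <= u -> h u = g u by move=> ?; rewrite /h max_l.
have intE (l : R -> R) v : t0 <= v -> \int[mu]_(s in `[- r, 0]) (l s * h (v + s)) =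
    \int[mu]_(s in `[- r, 0]) (l s * g (v + s)).
  move=> tv; apply: eq_Rintegral => s; rewrite inE /= in_itv /= => /andP[s1 _].
  by rewrite hE //; lra.
have tD : `[t0, +oo[%classic t by rewrite /= in_itv /= tt.
apply: (@eq_dwithin _ _ (fun t => \int[mu]_(s in `[- r, 0]) (k s * h (t + s)))) => //.
  by move=> s; rewrite /= in_itv /= andbT => ts; exact: intE.
apply: (@dwithin_subset _ setT) => //.
have := @window_derive R r t k k' h r0 ck' dk1 dk2 (continuous_clamp cg).
rewrite intE // !hE //; lra.
Qed.

Definition mdwithin (D : set R) k l (G : R -> 'M[R]_(k, l)) (t : R) (G' : 'M[R]_(k, l)) :=
  forall i j, dwithin D (fun s => G s i j) t (G' i j).

Lemma mdwithin_mull D k l o (A : 'M[R]_(k, l)) (G : R -> 'M[R]_(l, o)) t G' :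
  mdwithin D G t G' -> mdwithin D (fun s => A *m G s) t (A *m G').
Proof.
move=> dG i j; rewrite mxE (_ : (fun _ => _) = fun s => \sum_z A i z * G s z j).
  by apply: dwithin_sum => z; exact: dwithinZ.
by apply/funext => s; rewrite mxE.
Qed.

Arguments mdwithin_mull {D k l o} A {G t G'} _ _ _.

Lemma mdwithin_trace D k (G : R -> 'M[R]_k) t G' :
  mdwithin D G t G' -> dwithin D (fun s => \tr (G s)) t (\tr G').
Proof. by move=> dG; apply: dwithin_sum => i. Qed.

Lemma dwithin_bform D k l (A : 'M[R]_(k, l)) (u : R -> 'cV[R]_k) (v : R -> 'cV[R]_l)
  t u' v' : mdwithin D u t u' -> mdwithin D v t v' ->
  dwithin D (fun s => bform A (u s) (v s)) t (bform A u' (v t) + bform A (u t) v').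
Proof.
move=> du dv; rewrite !bformE -big_split /=.
rewrite (_ : (fun _ => _) = fun s => \sum_i \sum_j A i j * (u s i 0 * v s j 0)).
  apply: dwithin_sum => i; rewrite -big_split /=; apply: dwithin_sum => j.
  by rewrite -mulrDr; apply/dwithinZ/dwithinM; [exact: du|exact: dv].
by apply/funext => s; rewrite bformE.
Qed.

Lemma mdwithin_col D k l (u : R -> 'cV[R]_k) (v : R -> 'cV[R]_l) t u' v' :
  mdwithin D u t u' -> mdwithin D v t v' ->
  mdwithin D (fun s => col_mx (u s) (v s)) t (col_mx u' v').
Proof.
move=> du dv i j; case: (split_ordP i) => i' ->.
  rewrite col_mxEu (_ : (fun _ => _) = fun s => u s i' j); first exact: du.
  by apply/funext => s; rewrite col_mxEu.
rewrite col_mxEd (_ : (fun _ => _) = fun s => v s i' j); first exact: dv.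
by apply/funext => s; rewrite col_mxEd.
Qed.

Variables (n d : nat) (t0 r : R) (f : R -> 'cV[R]_d) (M : 'M[R]_d).
Variables (Y P : 'M[R]_n) (Q : 'M[R]_(n, d * n)) (Rm : 'M[R]_(d * n)) (S U : 'M[R]_n).
Hypothesis r_gt0 : 0 < r.
Hypothesis f_cont : mxcont (- r) 0 f.
Hypothesis f_ode : forall th, - r <= th <= 0 ->
  is_derive_within `[- r, 0]%classic f th (M *m f th).
Variable x : R -> 'cV[R]_n.
Hypothesis x_cont : {within `[t0 - r, +oo[%classic, continuous x}.
Local Notation seg t := (fun th : R => x (t + th)).

Lemma seg_cont t : t0 <= t -> mxcont (- r) 0 (seg t).
Proof.
move=> tt i j; apply: (within_cont_shift (g := fun s => x s i j) (c := t0 - r)); last lra.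
exact: within_cont_coord.
Qed.

Let y u a := (Y *m x u) a 0.

Let y_cont a : {within `[t0 - r, +oo[, continuous (y ^~ a)}.
Proof.
apply: (@within_cont_eq _ _ (fun u => \sum_b Y a b * x u b 0)) => [u|].
  by rewrite /y mxE.
apply: within_cont_sum => b; apply: within_contM; first exact: within_cont_cst.
exact: within_cont_coord.
Qed.

Lemma fmoment_derive t : t0 <= t ->
  mdwithin `[t0, +oo[ (fun t => fmoment r f Y (seg t)) t
    (Y *m x t *m (f 0)^T - Y *m x (t - r) *m (f (- r))^T - fmoment r f Y (seg t) *m M^T).
Proof.
move=> tt a b.
have cMf : mxcont (- r) 0 (fun s => M *m f s) by apply: mxcontM => //; exact: mxcont_cst.
have dk s : - r <= s <= 0 -> dwithin `[- r, 0] (fun s => f s b 0) s ((M *m f s) b 0).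
  by move=> /f_ode; exact: dwithin_coord.
have mulE (u : 'cV[R]_n) (v : 'cV[R]_d) : (u *m v^T) a b = v b 0 * u a 0.
  by rewrite mxE big_ord1 [(v^T) _ _]mxE mulrC.
have := window_dwithin r_gt0 tt (@cMf b 0) dk (@y_cont a).
have -> : (fun t => \int[mu]_(s in `[- r, 0]) (f s b 0 * y (t + s) a)) =
    (fun s => fmoment r f Y (seg s) a b).
  by apply/funext => s; rewrite mxE; apply: eq_Rintegral => th _; rewrite mulE.
congr dwithin; rewrite [RHS]mxE [in RHS]mxE [X in _ = _ + X]mxE [X in _ = _ + X - _]mxE.
rewrite !mulE; congr (_ - _).
rewrite -mxintMr; last first.
  apply: mxcontM; first by apply: mxcont_mulc; exact: seg_cont.
  exact: mxcont_tr.
rewrite mxE; apply: eq_Rintegral => s _.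
by rewrite -mulmxA -trmx_mul mulE.
Qed.

Lemma qmoment_derive t k k' : t0 <= t -> {within `[- r, 0], continuous k'} ->
  (forall s, - r <= s <= 0 -> dwithin `[- r, 0] k s (k' s)) ->
  mdwithin `[t0, +oo[ (fun t => qmoment r Y k (seg t) (seg t)) t
    (k 0 *: ((Y *m x t) *m (Y *m x t)^T)
     - k (- r) *: ((Y *m x (t - r)) *m (Y *m x (t - r))^T)
     - qmoment r Y k' (seg t) (seg t)).
Proof.
move=> tt ck' dk a b.
have mulE c (u : 'cV[R]_n) : (c *: (u *m u^T)) a b = c * (u a 0 * u b 0).
  by rewrite mxE [in LHS]mxE big_ord1 [(u^T) _ _]mxE.
have := window_dwithin r_gt0 tt ck' dk (within_contM (@y_cont a) (@y_cont b)).
have E (l : R -> R) v : \int[mu]_(s in `[- r, 0]) (l s * (y (v + s) a * y (v + s) b)) =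
    qmoment r Y l (seg v) (seg v) a b.
  by rewrite mxE; apply: eq_Rintegral => th _; rewrite mulE.
have -> : (fun t => \int[mu]_(s in `[- r, 0]) (k s * (y (t + s) a * y (t + s) b))) =
    (fun s => qmoment r Y k (seg s) (seg s) a b) by apply/funext.
rewrite E; congr dwithin.
rewrite [RHS]mxE [in RHS]mxE [X in _ = _ + X]mxE [X in _ = _ + X - _]mxE.
by rewrite !mulE.
Qed.

Arguments fmoment_derive {t} _ _ _.
Arguments qmoment_derive {t k k'} _ _ _ _ _.

(** [f' = M f] is what makes the derivative of [eta] a function of [y1], [y2] and
    [eta]; the weight [th + r] vanishes at the old end of the window and has
    slope one, so its moment gains [r y1^T U y1] and loses [int y^T U y]. *)
Lemma lkfun_derive t (xd : 'cV[R]_n)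
  (a := Y *m xd) (y1 := Y *m x t) (y2 := Y *m x (t - r))
  (eta := cvec (fmoment r f Y (seg t)))
  (deta := kroncol n (f 0) *m y1 - kroncol n (f (- r)) *m y2
           - (M *t (1%:M : 'M[R]_n)) *m eta) :
  t0 <= t -> P^T = P -> Rm^T = Rm -> mdwithin `[t0, +oo[ x t xd ->
  dwithin `[t0, +oo[ (fun t => lkfun r f Y P Q Rm S U (seg t)) t
    (2 * (bform P a y1 + bform Q a eta + bform Q y1 deta + bform Rm eta deta)
     + bform (S + r *: U) y1 y1 - bform S y2 y2
     - \tr (U *m qmoment r Y (fun=> 1) (seg t) (seg t))).
Proof.
move=> tt Ps Rs dx.
have dZ : mdwithin `[t0, +oo[ (fun t => lkstate r f Y (seg t)) t (col_mx a deta).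
  apply: mdwithin_col.
    move=> i j; have := mdwithin_mull Y dx i j; congr dwithin.
    by apply/funext => s; rewrite addr0.
  have -> : deta = cvec (y1 *m (f 0)^T - y2 *m (f (- r))^T
      - fmoment r f Y (seg t) *m M^T).
    rewrite !cvecD !cvecN -!kroncol_cvec; congr (_ - _).
    by rewrite mul_tens_cvec mul1mx.
  move=> i j; rewrite !ord1 mxE.
  have := fmoment_derive tt (mxtens_unindex i).2 (mxtens_unindex i).1; congr dwithin.
  by apply/funext => s; rewrite [RHS]mxE.
have c0 : {within `[- r, 0], continuous (fun=> 0 : R)} by exact: within_cont_cst.
have c1 : {within `[- r, 0], continuous (fun=> 1 : R)} by exact: within_cont_cst.
have d1 (s : R) : - r <= s <= 0 -> dwithin `[- r, 0] (fun=> 1) s 0.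
  by move=> _; exact: dwithin_cst.
have dw (s : R) : - r <= s <= 0 -> dwithin `[- r, 0] (fun s => s + r) s 1.
  move=> _; apply: is_derive_dwithin.
  have := is_deriveD (is_derive_id s 1) (is_derive_cst r s 1).
  by rewrite addr0.
have dS := mdwithin_trace (mdwithin_mull S (qmoment_derive tt c0 d1)).
have dU := mdwithin_trace (mdwithin_mull U (qmoment_derive tt c1 dw)).
have := dwithinD (dwithinD (dwithin_bform (A := block_mx P Q Q^T Rm) dZ dZ) dS) dU.
congr dwithin.
have q0 : qmoment r Y (fun=> 0) (seg t) (seg t) = 0.
  apply/matrixP => i j; rewrite !mxE.
  transitivity (\int[mu]_(th in `[- r, 0]) (0 : R)).
    by apply: eq_Rintegral => th _; rewrite scale0r mxE.
  by rewrite Rintegral_cst ?mul0r //; exact: measurable_itv.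
rewrite q0 subr0 addNr add0r scale0r subr0 !scale1r !mulmxBr -!scalemxAr.
rewrite !raddfB /= mxtraceZ !trace_outer -/y1 -/y2.
rewrite /lkstate addr0 !bform_block -/y1 -/eta.
have -> : bform P y1 a = bform P a y1 by rewrite -bformT Ps.
have -> : bform Rm deta eta = bform Rm eta deta by rewrite -bformT Rs.
rewrite !bformT bformDl bformZl; ring.
Qed.

End SolutionSegments.

(** * The closed loop *)

Section ClosedLoop.
Context {R : realType}.
Local Notation mu := (@lebesgue_measure R).

Lemma dwithin_continuous (D : set R) (g l : R -> R) :
  (forall t, D t -> dwithin D g t (l t)) -> {within D, continuous g}.
Proof.
move=> dg; apply/within_contP => t e Dt e0.
have /dwithin_cvg/cvgrPdist_le/(_ e e0)[d /= d0 hd] := dg t Dt.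
exists d => // s Ds st; have [->|sNt] := eqVneq s t.
  by rewrite subrr normr0 ltW.
by rewrite distrC; apply: hd => //; rewrite /ball /= distrC.
Qed.

Lemma sqn_bform k (u : 'cV[R]_k) : sqn u = bform 1%:M u u.
Proof.
by rewrite /bform mulmx1 mxE; apply: eq_bigr => i _; rewrite mxE expr2.
Qed.

Lemma sqn_mul_bound k l (A : 'M[R]_(k, l)) :
  exists2 c : R, 0 < c & forall u, sqn (A *m u) <= c * sqn u.
Proof.
have [c c0 hc] := bform_bound (A^T *m A); exists c => // u.
apply: le_trans (le_trans (ler_norm _) (hc u)).
by rewrite sqn_bform bform_mull mulmx1 bformM.
Qed.

Variables (n q d : nat) (t0 r : R) (f : R -> 'cV[R]_d) (M : 'M[R]_d).
Hypothesis r_gt0 : 0 < r.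
Hypothesis f_cont : mxcont (- r) 0 f.
Hypothesis f_ode : forall th, - r <= th <= 0 ->
  is_derive_within `[- r, 0]%classic f th (M *m f th).

Lemma chi_fmoment (Y : 'M[R]_n) (phi : R -> 'cV[R]_n) : mxcont (- r) 0 phi ->
  ((1%:M : 'M[R]_d) *t Y) *m mxint `[- r, 0]%classic (fun th => kroncol n (f th) *m phi th)
  = cvec (fmoment r f Y phi).
Proof.
move=> cp.
have -> : mxint `[- r, 0]%classic (fun th => kroncol n (f th) *m phi th) =
    cvec (mxint `[- r, 0]%classic (fun th => phi th *m (f th)^T)).
  apply/colP => k; rewrite [RHS]mxE [RHS]mxE mxE; apply: eq_Rintegral => th _.
  by rewrite kroncol_cvec mxE.
rewrite mul_tens_cvec trmx1 mulmx1 -mxintMl; last first.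
  by apply: mxcontM => //; exact: mxcont_tr.
by congr cvec; apply: eq_mxint => th _; rewrite mulmxA.
Qed.

(** The entries that are not shifted states are the moments, which are even
    differentiable. *)
Lemma chi0_cont (x : R -> 'cV[R]_n) (i : 'I_((2 + d) * n + q)) :
  {within `[t0 - r, +oo[%classic, continuous x} ->
  {within `[t0, +oo[%classic, continuous (fun t => chi r f x (fun=> 0) t i 0)}.
Proof.
move=> cx; rewrite /chi /col4.
have sub a b : 0 <= b -> {within `[t0, +oo[%classic, continuous (fun t => x (t - r + b) a 0)}.
  move=> b0; have /within_contP c := within_cont_coord (i := a) (j := 0) cx.
  apply/within_contP => t e /=; rewrite in_itv /= andbT => tt e0.
  have [|dl dl0 hd] := c (t - r + b) e _ e0; first by rewrite /= in_itv /= andbT; lra.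
  exists dl => // s; rewrite /= in_itv /= andbT => ts st; apply: hd.
    by rewrite /= in_itv /= andbT; lra.
  by have -> : s - r + b - (t - r + b) = s - t by ring.
case: (split_ordP i) => i' ->; last first.
  apply: (@within_cont_eq _ _ (fun=> 0)) => [t|]; last exact: within_cont_cst.
  by rewrite col_mxEd mxE.
apply: (@within_cont_eq _ _ (fun t => col_mx (x t) (col_mx (x (t - r))
    (mxint `[- r, 0]%classic (fun th => kroncol n (f th) *m x (t + th)))) i' 0)) => [t|].
  by rewrite col_mxEu.
case: (@split_ordP n (n + d * n) i') => j ->.
  apply: (@within_cont_eq _ _ (fun t => x (t - r + r) j 0)) => [t|].
    by rewrite col_mxEu subrK.
  by apply: sub; exact: ltW.
case: (split_ordP j) => k ->.
  apply: (@within_cont_eq _ _ (fun t => x (t - r + 0) k 0)) => [t|].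
    by rewrite col_mxEd col_mxEu addr0.
  exact: sub.
pose g := fun t => fmoment r f 1%:M (fun th => x (t + th))
  (mxtens_unindex k).2 (mxtens_unindex k).1.
have cg : {within `[t0, +oo[%classic, continuous g}.
  apply: (dwithin_continuous (l := fun t => _)) => t; rewrite /= in_itv /= andbT => tt.
  have := @fmoment_derive R n d t0 r f M 1%:M r_gt0 f_cont f_ode x cx t tt
    (mxtens_unindex k).2 (mxtens_unindex k).1.
  exact.
move: cg => /within_contP cg; apply/within_contP => t e Dt e0.
have [dl dl0 hd] := cg t e Dt e0; exists dl => // s Ds st.
have gE u : `[t0, +oo[%classic u -> col_mx (x u) (col_mx (x (u - r))
    (mxint `[- r, 0]%classic (fun th => kroncol n (f th) *m x (u + th))))
    (rshift n (rshift n k)) 0 = g u.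
  rewrite /= in_itv /= andbT => tu; rewrite !col_mxEd.
  have cs : mxcont (- r) 0 (fun th => x (u + th)) by exact: (@seg_cont R n t0 r x cx u tu).
  rewrite mxE /g [RHS]mxE; apply: eq_Rintegral => th _.
  by rewrite kroncol_cvec mxE mul1mx.
by rewrite !gE //; exact: hd.
Qed.

(** With zero disturbance the right-hand side is a continuous function of time,
    so the almost everywhere equation holds at every instant. *)
Lemma undisturbed_holds_everywhere (Acl : 'M[R]_(n, (2 + d) * n + q))
  (phi x : R -> 'cV[R]_n) (t : R) :
  cls_solution t0 r f Acl phi (fun=> (0 : 'cV[R]_q)) x -> t0 <= t ->
  mdwithin `[t0, +oo[ x t (Acl *m chi r f x (fun=> 0) t).
Proof.
move=> [cx _ acx aex] tt i j; rewrite ord1 => {j}.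
apply: (@ac_derive_everywhere R (fun s => x s i 0)
  (fun t => (Acl *m chi r f x (fun=> 0) t) i 0)) => //.
- by move=> T tT; apply: ac_coord; exact: acx.
- case: aex => N [mN N0 NP]; exists N; split=> // s /= hs.
  apply: NP => /= hold; apply: hs => ts.
  by apply: dwithin_coord; exact: hold.
- apply: (@within_cont_eq _ _ (fun t => \sum_j Acl i j * chi r f x (fun=> 0) t j 0)) => [s|].
    by rewrite mxE.
  apply: within_cont_sum => j; apply: within_contM; first exact: within_cont_cst.
  exact: chi0_cont.
Qed.

(** [V s * exp (la (s - t0))] has nonpositive derivative. *)
Lemma exponential_bound (V : R -> R) (la t : R) : t0 <= t ->
  (forall s, t0 <= s -> exists2 l, l <= - la * V s & dwithin `[t0, +oo[ V s l) ->
  V t <= V t0 * expR (- la * (t - t0)).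
Proof.
move=> tt dV.
have dE (s : R) : is_derive s 1 (fun s => expR (la * (s - t0))) (la * expR (la * (s - t0))).
  have d1 : is_derive s 1 (fun s : R => la * (s - t0)) la.
    have := is_deriveZ la (is_deriveB (is_derive_id s 1) (is_derive_cst t0 s 1)).
    by rewrite subr0 /GRing.scale /= mulr1.
  have := @is_derive1_comp R expR (fun s : R => la * (s - t0)) s _ _ (is_derive_expR _) d1.
  by rewrite mulrC.
have : V t * expR (la * (t - t0)) - V t0 * expR (la * (t0 - t0)) <= 0 * (t - t0).
  apply: (derivative_le_increment (g := fun s => V s * expR (la * (s - t0)))) => //.
  move=> s /andP[s1 s2]; have [l ll dl] := dV s s1.
  exists (l * expR (la * (s - t0)) + V s * (la * expR (la * (s - t0)))).
    rewrite mulrCA mulrA -mulrDl mulr_le0_ge0 ?expR_ge0 //; lra.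
  apply: (@dwithin_subset _ `[t0, +oo[%classic) => [z|].
    by rewrite /= !in_itv /= andbT => /andP[].
  by apply: dwithinM => //; exact: is_derive_dwithin.
rewrite subrr mulr0 expR0 mulr1 mul0r subr_le0 => h.
by rewrite mulNr expRN ler_pdivlMr ?expR_gt0.
Qed.

End ClosedLoop.

(** * Dissipativity and exponential stability *)

Theorem theorem2p2 (R : realType) (n p q m d : nat) (t0 r : R)
  (f : R -> 'cV[R]_d) (M : 'M[R]_d)
  (A1 A2 : 'M[R]_n) (A3 : 'M[R]_(n, d * n))
  (B1 B2 : 'M[R]_(n, p)) (B3 : 'M[R]_(n, d * p)) (D1 : 'M[R]_(n, q))
  (C1 C2 : 'M[R]_(m, n)) (C3 : 'M[R]_(m, d * n))
  (B4 B5 : 'M[R]_(m, p)) (B6 : 'M[R]_(m, d * p)) (D2 : 'M[R]_(m, q))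
  (J1 Jt : 'M[R]_m) (J2 : 'M[R]_(m, q)) (J3 : 'M[R]_q)
  (alpha : 'I_(2 + d) -> R)
  (bA := row4 A1 A2 A3 D1) (bB1 := row4 B1 B2 B3 (0 : 'M[R]_(n, q)))
  (bC := row4 C1 C2 C3 D2) (bB2 := row4 B4 B5 B6 (0 : 'M[R]_(m, q)))
  (r_gt0 : 0 < r)
  (f_C1 : C1_on `[- r, 0]%classic f)
  (f_ode : forall th, - r <= th <= 0 ->
    is_derive_within `[- r, 0]%classic f th (M *m f th))
  (f_gram : posdefmx (gram r f))
  (J1_sym : J1^T = J1) (J1_unit : J1 \in unitmx)
  (J1_neg : negdefmx (invmx J1)) (J3_sym : J3^T = J3)
  (P X : 'M[R]_n) (V : 'M[R]_(p, n)) (Q : 'M[R]_(n, d * n))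
  (Rm : 'M[R]_(d * n)) (S U : 'M[R]_n)
  (P_sym : P^T = P) (Rm_sym : Rm^T = Rm) (S_sym : S^T = S) (U_sym : U^T = U)
  (lmi_PQRS : posdefmx (block_mx P Q Q^T (Rm + sfF r f *t S)))
  (lmi_S : posdefmx S) (lmi_U : posdefmx U)
  (lmi_main : negdefmx (LMI_main alpha X
    (LMI_Pi m bA bB1 X V) (LMI_P q m P Q)
    (LMI_Phi r f M Q Rm S U (LMI_Sigma C1 C2 C3 D2 B4 B5 B6 X V)
       J1 Jt J2 J3))) :
  X \in unitmx /\
  let K := V *m invmx X in
  dissipative t0 r f (closed_loop bA bB1 K) (closed_loop bC bB2 K)
    (supply J1 Jt J2 J3) /\
  exponentially_stable t0 r f (closed_loop bA bB1 K).
Proof.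
have [uX [e e0 he]] := LMI_dissipation J1_sym J1_unit lmi_main.
split=> // K; set Acl := closed_loop bA bB1 K; set Ccl := closed_loop bC bB2 K.
pose Y := invmx X; pose v := lkfun r f Y P Q Rm S U.
have f_cont : mxcont (- r) 0 f.
  move=> i j; rewrite ord1 => {j}.
  apply: (dwithin_continuous (l := fun th => (M *m f th) i 0)) => th.
  by rewrite /= in_itv /= => /f_ode; exact: dwithin_coord.
pose sgm (x : R -> 'cV[R]_n) t := fun th : R => x (t + th).
pose E (phi : R -> 'cV[R]_n) := sqn (Y *m phi 0) + sqn (cvec (fmoment r f Y phi)).
pose q1 phi := \tr (U *m qmoment r Y (fun=> 1) phi phi).
pose be phi := bform (sfF r f *t U) (cvec (fmoment r f Y phi)) (cvec (fmoment r f Y phi)).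
(* the Bessel gap [q1 - be] is kept: dissipativity drops it, stability needs it *)
have key x w t : {within `[t0 - r, +oo[%classic, continuous x} -> t0 <= t ->
    mdwithin `[t0, +oo[ x t (Acl *m chi r f x w t) ->
    exists2 dv, dwithin `[t0, +oo[ (fun t' => v (sgm x t')) t dv &
      dv - supply J1 Jt J2 J3 (Ccl *m chi r f x w t) (w t) <=
      - e * E (sgm x t) - (q1 (sgm x t) - be (sgm x t)).
  move=> cx tt dx; have cs : mxcont (- r) 0 (sgm x t) by exact: (seg_cont cx tt).
  have dv := lkfun_derive (Y := Y) (Q := Q) (S := S) (U := U)
    r_gt0 f_cont f_ode cx tt P_sym Rm_sym dx.
  refine (ex_intro2 _ _ _ dv _).
  have := he (x t) (x (t - r))
    (mxint `[- r, 0]%classic (fun th => kroncol n (f th) *m x (t + th))) (w t).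
  cbv zeta; rewrite (chi_fmoment f_cont Y cs) -/(chi r f x w t) -/Y.
  rewrite /E /q1 /be /sgm addr0 -/K -/Acl -/Ccl; lra.
have Bes phi : mxcont (- r) 0 phi -> be phi <= q1 phi by exact: Bessel_qmoment.
have E0 phi : 0 <= E phi by rewrite addr_ge0 ?sqn_ge0.
have [el el0 vlow] := lkfun_lower Y f_cont f_gram lmi_S lmi_U lmi_PQRS.
have bb := lkform_bilinear Y P Q Rm S U r_gt0 f_cont.
split.
  exists v; split.
  - exact: lkfun_histories.
  - move=> phi /mxcont_within cphi; apply: le_trans (vlow phi cphi).
    exact: mulr_ge0 (ltW el0) (sqn_ge0 _).
  - exact: (differentiable_quadratic (ltW r_gt0) bb).
  - move=> phi w x _ _ [cx _ _ _] t tt ht.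
    have [|dv dvE dvle] := key x w t cx tt.
      by move=> i j; rewrite ord1; exact: dwithin_coord.
    exists dv; first exact: dvE.
    have := Bes _ (seg_cont cx tt); have : 0 <= e * E (sgm x t) by rewrite mulr_ge0 // ltW.
    by move: dvle; rewrite -/(sgm x t); lra.
have [c c0 hc] := lkfun_upper f Y P Q Rm S r_gt0 lmi_U.
have [cb cb0 hcb] := bform_bound (sfF r f *t U).
have [cX cX0 hcX] := sqn_mul_bound X.
have [C C0 hC] := (let: And3 _ _ h := bb in h).
(* Only the fraction [de] of the Bessel gap [q1 - be] is kept: the cost
   [de * be] is absorbed by half of the margin [e * E], and what remains
   controls [E + q1], hence the functional. *)
pose de := Num.min 1 (e / 2 / cb).
have de0 : 0 < de by rewrite lt_min ltr01 !divr_gt0.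
have de1 : de <= 1 by rewrite ge_min lexx.
have decb : de * cb <= e / 2 by rewrite -ler_pdivlMr // ge_min lexx orbT.
pose la := Num.min (e / 2) de / c.
have la0 : 0 < la by rewrite divr_gt0 // lt_min divr_gt0.
pose k := Num.sqrt (cX / el * C + 1).
have k0 : 0 < k by rewrite sqrtr_gt0 ltr_wpDl // mulr_ge0 // divr_ge0 // ltW.
have la2 : 0 < la / 2 by rewrite divr_gt0.
exists k, (la / 2); split=> // phi x hphi sol t tt.
have cphi := mxcont_within hphi.
have [cx xphi _ _] := sol.
have decay s : t0 <= s -> exists2 l, l <= - la * v (sgm x s) &
    dwithin `[t0, +oo[ (fun t' => v (sgm x t')) s l.
  move=> ts; have cs := seg_cont cx ts.
  have [dv dvE dvle] := key x (fun=> 0) s cx ts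
    (undisturbed_holds_everywhere r_gt0 f_cont f_ode sol ts).
  exists dv => //.
  have s0 : supply J1 Jt J2 J3 (Ccl *m chi r f x (fun=> 0) s) 0 <= 0.
    set z := Ccl *m _; rewrite /supply -/(bform _ (col_mx z 0) (col_mx z 0)) bform_block.
    have zr a (B : 'M[R]_(a, q)) u : bform B u 0 = 0 by rewrite /bform mulmx0 mxE.
    have zl a (B : 'M[R]_(q, a)) u : bform B 0 u = 0 by rewrite -bformT zr.
    rewrite !zr zl !addr0 bformM -bform_mull.
    by have := posdef_ge0 (Jt *m z) J1_neg; rewrite bformNl oppr_ge0.
  have vE : v (sgm x s) <= c * (E (sgm x s) + q1 (sgm x s)) by exact: hc.
  have bE : be (sgm x s) <= cb * E (sgm x s).
    apply: le_trans (ler_norm _) _; apply: le_trans (hcb _) _.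
    by rewrite ler_wpM2l ?(ltW cb0) // lerDr sqn_ge0.
  have bq := Bes _ cs; have Es := E0 (sgm x s).
  have q0 : 0 <= q1 (sgm x s).
    by apply: tr_qmoment_ge0 => //; exact: within_cont_cst.
  move: vE bE bq Es q0 dvle; rewrite -/(sgm x s).
  move: (v _) (E _) (q1 _) (be _) => vs Es qs bs vE bE bq Es0 q0 dvle.
  have m1 : Num.min (e / 2) de <= e / 2 by rewrite ge_min lexx.
  have m2 : Num.min (e / 2) de <= de by rewrite ge_min lexx orbT.
  have lavs : la * vs <= Num.min (e / 2) de * (Es + qs).
    have m0 : 0 <= Num.min (e / 2) de by rewrite ltW // lt_min divr_gt0.
    by rewrite /la mulrAC ler_pdivrMr // -mulrA [_ * c]mulrC ler_wpM2l.
  have h1 : Num.min (e / 2) de * Es <= e / 2 * Es by rewrite ler_wpM2r.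
  have h2 : Num.min (e / 2) de * qs <= de * qs by rewrite ler_wpM2r.
  have h3 : de * (qs - bs) <= qs - bs by rewrite ler_piMl // subr_ge0.
  have h4 : de * bs <= de * (cb * Es) by rewrite ler_wpM2l // ltW.
  have h5 : de * (cb * Es) <= e / 2 * Es by rewrite mulrA ler_wpM2r.
  lra.
have Vt := exponential_bound tt decay.
have vt0 : v (sgm x t0) <= C * (supnorm r phi * supnorm r phi).
  have -> : v (sgm x t0) = v phi by apply: lkfun_histories => // th thr; exact: xphi.
  exact: le_trans (ler_norm _) (hC phi phi cphi cphi).
have xt : sqn (x t) <= (k * supnorm r phi * expR (- (la / 2) * (t - t0))) ^+ 2.
  have sE : x t = X *m (Y *m x t) by rewrite mulKVmx.
  have v1 := vlow _ (seg_cont cx tt); rewrite addr0 in v1.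
  rewrite sE; apply: le_trans (hcX _) _.
  (* squaring doubles the decay rate to [la] *)
  have -> : (k * supnorm r phi * expR (- (la / 2) * (t - t0))) ^+ 2 =
      (cX / el * C + 1) * (supnorm r phi * supnorm r phi * expR (- la * (t - t0))).
    have kE : k ^+ 2 = cX / el * C + 1 by rewrite sqr_sqrtr // ltW // -sqrtr_gt0.
    have xE : expR (- (la / 2) * (t - t0)) ^+ 2 = expR (- la * (t - t0)).
      by rewrite -expRM_natl; congr expR; field.
    by rewrite !exprMn kE xE; ring.
  set ss := supnorm r phi * supnorm r phi; set ex := expR _.
  have ss0 : 0 <= ss by rewrite /ss -expr2 sqr_ge0.
  have ex0 : 0 <= ex by exact: expR_ge0.
  apply: (@le_trans _ _ (cX / el * C * (ss * ex))); last first.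
    by apply: ler_wpM2r; [exact: mulr_ge0|rewrite lerDl].
  have -> : cX / el * C * (ss * ex) = cX * (C * ss * ex / el) by ring.
  rewrite ler_wpM2l ?(ltW cX0) // ler_pdivlMr // mulrC.
  by apply: le_trans v1 (le_trans Vt _); rewrite ler_wpM2r.
have k0' : 0 <= k * supnorm r phi * expR (- (la / 2) * (t - t0)).
  by rewrite !mulr_ge0 ?expR_ge0 ?(ltW k0) // supnorm_ge0 // ltW.
apply: norm_le_coord => // i j; rewrite ord1 -ler_sqr ?nnegrE //.
by rewrite real_normK ?num_real //; exact: le_trans (le_sqn_coord _ _) xt.
Qed.
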